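(* Let $(\phi_t)$ be a non-elliptic semigroup in $\mathbb{D}$, with Denjoy-Wolff point $\tau\in \partial \mathbb{D}$ and total speed $v(t)$. \begin{itemize} \item If $(\phi_t)$ is hyperbolic with spectral value $\lambda> 0$, then $\liminf_{t\to+\infty}[v(t)-\frac{\lambda}{2}t]>-\infty$; \item if $(\phi_t)$ is parabolic of positive hyperbolic step, then $\liminf_{t\to+\infty}[v(t)-\log t]>-\infty$; \item if $(\phi_t)$ is parabolic of zero hyperbolic step, then $\liminf_{t\to+\infty}[v(t)-\frac{1}{4}\log t]>-\infty$. \end{itemize}
   Context: Let $\mathbb{D}=\{\zeta\in\mathbb{C}:|\zeta|<1\}$ with hyperbolic distance $\omega(z,w)=\frac12\log\frac{1+|T_z(w)|}{1-|T_z(w)|}$, $T_z(w)=\frac{z-w}{1-\overline{z}w}$. A non-elliptic semigroup in $\mathbb{D}$ is a family $(\phi_t)_{t\ge0}$ of holomorphic maps $\phi_t:\mathbb{D}\to\mathbb{D}$ such that $\phi_0=\mathrm{id}$, $\phi_{t+s}=\phi_t\circ\phi_s$ for all $s,t\ge0$, $t\mapsto\phi_t$ is continuous for the topology of uniform convergence on compacta of $\mathbb{D}$, and $\phi_t$ has no fixed point in $\mathbb{D}$ for $t>0$. Its Denjoy-Wolff point is the unique $\tau\in\partial\mathbb{D}$ such that $\lim_{t\to\infty}\phi_t(z)=\tau$ for all $z\in\mathbb{D}$. The angular derivative satisfies $\phi_t'(\tau)=e^{-\lambda t}$ for all $t\ge0$, where $\lambda\ge0$ is the spectral value. Every such semigroup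 has an (essentially unique) holomorphic model $(\Omega,h,z+it)$: $h:\mathbb{D}\to\mathbb{C}$ (the Koenigs function) is univalent, $h(\mathbb{D})+it\subseteq h(\mathbb{D})$ and $h(\phi_t(z))=h(z)+it$ for all $z\in\mathbb{D}$, $t\ge0$, and $\Omega=\bigcup_{t\ge0}(h(\mathbb{D})-it)$ is either a strip $\{0<\mathrm{Re}\,z<\pi/\lambda\}$ (with $\lambda>0$ the spectral value), the right half plane $\{\mathrm{Re}\,z>0\}$, the left half plane $\{\mathrm{Re}\,z<0\}$, or $\mathbb{C}$. The semigroup is hyperbolic if $\Omega$ is a strip (equivalently $\lambda>0$) and parabolic otherwise (equivalently $\lambda=0$). A parabolic semigroup is of positive hyperbolic step if $\Omega$ is a half plane (equivalently $\lim_{t\to\infty}\omega(\phi_t(z),\phi_{t+1}(z))>0$ for some, hence any, $z\in\mathbb{D}$), and of zero hyperbolic step if $\Omega=\mathbb{C}$. The total speed is $v(t):=\omega(0,\phi_t(0))$, $t\ge0$. *)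

(* Defs.v *)
From HB Require Import structures.
From mathcomp Require Import all_boot all_order all_algebra.
From mathcomp Require Import complex.
From mathcomp Require Import all_classical all_reals all_analysis.

Set Implicit Arguments.
Unset Strict Implicit.
Unset Printing Implicit Defensive.

Import Order.TTheory GRing.Theory Num.Theory.
Import numFieldTopology.Exports numFieldNormedType.Exports.

Local Open Scope classical_set_scope.
Local Open Scope ring_scope.
Local Open Scope complex_scope.

(* The topology and the normed space structure over R[i] are carried by the
   alias R[i]^o; the functions themselves have type R[i] -> R[i], and only
   their values on the unit disc matter. *)

Definition disc (R : realType) : set R[i] := [set z | `|z| < 1].
Arguments disc : clear implicits.

Definition hyp_dist (R : realType) (z w : R[i]) : R :=
  let r := Normc.normc ((z - w) / (1 - z^* * w)) in
  2^-1 * ln ((1 + r) / (1 - r)).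

Definition holomorphic (R : realType) (D : set R[i]) (f : R[i] -> R[i]) :=
  forall z, D z -> derivable (f : R[i]^o -> R[i]^o) z 1.

Definition univalent (R : realType) (D : set R[i]) (f : R[i] -> R[i]) :=
  holomorphic D f /\ {in D &, injective f}.

Record nonelliptic_semigroup (R : realType) (phi : R -> R[i] -> R[i]) : Prop :=
  NonellipticSemigroup {
  nes_self : forall (t : R) (z : R[i]), 0 <= t -> disc R z -> disc R (phi t z) ;
  nes_holo : forall t : R, 0 <= t -> holomorphic (disc R) (phi t) ;
  nes_id : forall z, disc R z -> phi 0 z = z ;
  nes_add : forall (s t : R) (z : R[i]), 0 <= s -> 0 <= t -> disc R z ->
    phi (t + s) z = phi t (phi s z) ;
  nes_cont : forall (t0 : R) (K : set R[i]^o), 0 <= t0 ->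
    compact K -> K `<=` disc R ->
    {uniform K, (phi t : R[i]^o -> R[i]^o) @[t --> within `[0, +oo[ (nbhs t0)]
       --> (phi t0 : R[i]^o -> R[i]^o)} ;
  nes_nofix : forall (t : R) (z : R[i]), 0 < t -> disc R z -> phi t z <> z }.

Definition denjoy_wolff (R : realType) (phi : R -> R[i] -> R[i]) (tau : R[i]) :=
  `|tau| = 1 /\
  forall z, disc R z -> (phi t z : R[i]^o) @[t --> +oo] --> (tau : R[i]^o).

Definition stolz (R : realType) (sigma : R[i]) (M : R) : set R[i] :=
  [set z | disc R z /\ `|sigma - z| < M%:C * (1 - `|z|)].

Definition angular_lim (R : realType) (f : R[i] -> R[i]) (sigma w : R[i]) :=
  forall M : R, 1 < M ->
  (f z : R[i]^o) @[z --> within (stolz sigma M) (nbhs (sigma : R[i]^o))]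
    --> (w : R[i]^o).

(* f has angular limit w and angular derivative d at the boundary point sigma *)
Definition angular_derivative (R : realType) (f : R[i] -> R[i])
    (sigma w d : R[i]) :=
  angular_lim f sigma w /\
  angular_lim (fun z => (f z - w) / (z - sigma)) sigma d.

Definition spectral_value (R : realType) (phi : R -> R[i] -> R[i]) (tau : R[i])
    (lambda : R) :=
  0 <= lambda /\
  forall t : R, 0 <= t ->
    angular_derivative (phi t) tau tau (expR (- (lambda * t)))%:C.

Definition holomorphic_model (R : realType) (phi : R -> R[i] -> R[i])
    (h : R[i] -> R[i]) (Omega : set R[i]) :=
  [/\ univalent (disc R) h,
      forall (t : R) w, 0 <= t ->
        (h @` disc R) w -> (h @` disc R) (w + t*i),
      forall (t : R) z, 0 <= t -> disc R z -> h (phi t z) = h z + t*i &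
      Omega = [set w | exists2 t : R, 0 <= t &
                       exists2 z, disc R z & w = h z - t*i]].

Definition strip (R : realType) (a : R) : set R[i] :=
  [set z | 0 < complex.Re z < a].
Definition right_half_plane (R : realType) : set R[i] :=
  [set z | 0 < complex.Re z].
Definition left_half_plane (R : realType) : set R[i] :=
  [set z | complex.Re z < 0].

(* As models are essentially unique, the type of a semigroup is read off from
   any model whose domain is one of the four canonical ones. *)
Definition hyperbolic (R : realType) (phi : R -> R[i] -> R[i]) :=
  exists2 mu : R, 0 < mu & exists h, holomorphic_model phi h (strip (pi / mu)).

Definition parabolic_positive_step (R : realType) (phi : R -> R[i] -> R[i]) :=
  exists h, holomorphic_model phi h (@right_half_plane R) \/
            holomorphic_model phi h (@left_half_plane R).

Definition parabolic_zero_step (R : realType) (phi : R -> R[i] -> R[i]) :=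
  exists h, holomorphic_model phi h setT.

Definition total_speed (R : realType) (phi : R -> R[i] -> R[i]) (t : R) : R :=
  hyp_dist 0 (phi t 0).

(* Main.v *)
Require Import Defs.
From mathcomp Require Import all_boot all_order all_algebra.
From mathcomp Require Import complex.
From mathcomp Require Import all_classical all_reals all_analysis.
From mathcomp Require Import ring lra.

Import Order.TTheory GRing.Theory Num.Theory.
Import numFieldTopology.Exports numFieldNormedType.Exports.

Local Open Scope classical_set_scope.
Local Open Scope ring_scope.
Local Open Scope complex_scope.

(** Write [r = |phi_t(0)|], so that [v(t) = 1/2 ln ((1 + r) / (1 - r))].  Each
    of the three bounds is an upper bound on [1 - r], obtained from one
    application of the Schwarz lemma.

    - Spectral value [lambda > 0].  Schwarz-Pick between [0] and a point of the
      radius ending at [tau], where the difference quotient of [phi_t] is close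
      to [exp (- lambda t)], gives Julia's inequality
      [1 - r <= 4 exp (- lambda t) (1 + r)] ([julia_origin]).
    - Half-plane model.  Up to sign, the Koenigs function [h] maps the disc to
      the right half plane and [h (phi_t 0) = h 0 + i t]; the Schwarz lemma for
      this target ([schwarz_half_plane]) yields
      [(1 - r^2) t^2 <= 4 (Re (h 0))^2].
    - Model [C].  The image of [h] is not [C] ([injective_not_onto]); as it is
      stable under upward translation, it misses a whole half-line
      [p - i s], [s >= 0].  So [g = sqrt (- i (h - p))], with [Re g > 0], is
      holomorphic ([koebe_sqrt]), and the half-plane inequality for [g], where
      [g (phi_t 0)^2] has real part [t + O(1)], bounds [(1 - r^2)^2 t].

    The complex analysis behind this is built from pointwise differentiability
    alone.  Goursat's bisection argument ([contour_eq0]) gives local primitives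
    ([local_primitive]).  If [F' = f] then [F] has second-order expansions, and
    so do its difference quotients, whose real parts therefore have no
    interior maximum once a positive multiple of [|z|^2] is added to them; as these
    quotients approximate [f], the maximum principle holds for [f]
    ([max_principle]).  The Schwarz lemma follows without removing
    singularities, by applying the maximum principle to [f^(n+1) / z^n], and so
    does the open mapping property of injective functions ([injective_open]).
    Finally, if an injective [h] took the disc onto the plane, its inverse would
    be continuous and [h] would tend to infinity at the boundary; the maximum
    principle for [(z - a)^2 / (h z - h a)] would force this function to
    vanish. *)

Set Implicit Arguments.
Unset Strict Implicit.
Unset Printing Implicit Defensive.

(** * The real-valued modulus of a complex number *)

Section Modulus.
Variable R : realType.
Implicit Types (z w : R[i]) (x e : R).
Notation nc := (@Normc.normc R).

Lemma norm_nc z : `|z| = (nc z)%:C.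
Proof. by case: z => a b; rewrite normc_def. Qed.

Lemma nc_ge0 z : 0 <= nc z.
Proof. by case: z => a b /=; exact: sqrtr_ge0. Qed.

Lemma ncD z w : nc (z + w) <= nc z + nc w.
Proof. exact: le_normcD. Qed.

Lemma ncN z : nc (- z) = nc z.
Proof. exact: normcN. Qed.

Lemma ncC z w : nc (z - w) = nc (w - z).
Proof. by rewrite -opprB ncN. Qed.

Lemma nc_eq0 z : (nc z == 0) = (z == 0).
Proof. by apply/eqP/eqP => [/Normc.eq0_normc//|->]; rewrite Normc.normc0. Qed.

Lemma nc_gt0 z : (0 < nc z) = (z != 0).
Proof. by rewrite lt_def nc_ge0 andbT nc_eq0. Qed.

Lemma ncX z n : nc (z ^+ n) = nc z ^+ n.
Proof.
by elim: n => [|n IHn]; rewrite ?expr0 ?Normc.normc1// !exprS Normc.normcM IHn.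
Qed.

Lemma nc_real x : nc x%:C = `|x|.
Proof. by rewrite /= expr0n /= addr0 sqrtr_sqr. Qed.

Lemma nc_sqr z : nc z ^+ 2 = complex.Re z ^+ 2 + complex.Im z ^+ 2.
Proof. by case: z => a b /=; rewrite sqr_sqrtr// addr_ge0// sqr_ge0. Qed.

Lemma nc_conj z : nc z^* = nc z.
Proof. by case: z => a b /=; rewrite sqrrN. Qed.

Lemma normRe z : `|complex.Re z| <= nc z.
Proof.
by case: z => a b /=; rewrite -sqrtr_sqr ler_wsqrtr// lerDl sqr_ge0.
Qed.

Lemma normIm z : `|complex.Im z| <= nc z.
Proof.
by case: z => a b /=; rewrite -sqrtr_sqr ler_wsqrtr// lerDr sqr_ge0.
Qed.

Lemma nc_le_ReIm z : nc z <= `|complex.Re z| + `|complex.Im z|.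
Proof.
rewrite -(@ler_pXn2r _ 2%N)// ?nnegrE ?nc_ge0 ?addr_ge0//.
rewrite nc_sqr -(real_normK (num_real (complex.Re z))).
rewrite -(real_normK (num_real (complex.Im z))).
have := normr_ge0 (complex.Re z); have := normr_ge0 (complex.Im z); nra.
Qed.

Lemma ncB z w : nc z - nc w <= nc (z - w).
Proof. by rewrite lerBlDr; apply: le_trans (ncD _ _); rewrite subrK. Qed.

Lemma ReD z w : complex.Re (z + w) = complex.Re z + complex.Re w.
Proof. by case: z w => ? ? [? ?]. Qed.

Lemma ReB z w : complex.Re (z - w) = complex.Re z - complex.Re w.
Proof. by case: z w => ? ? [? ?]. Qed.

Lemma ImB z w : complex.Im (z - w) = complex.Im z - complex.Im w.
Proof. by case: z w => ? ? [? ?]. Qed.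

Lemma ReIm_eq z w :
  complex.Re z = complex.Re w -> complex.Im z = complex.Im w -> z = w.
Proof. by case: z w => ? ? [? ?] /= -> ->. Qed.

(** A positive complex number is real, so that epsilons in [R[i]] can be
    replaced by real ones. *)
Lemma posC (e : R[i]) : 0 < e -> exists2 x, 0 < x & e = x%:C.
Proof. by case: e => a b; rewrite ltcE /= => /andP[/eqP -> ?]; exists a. Qed.

End Modulus.

(** * Complex continuity and differentiability with real epsilons *)

Section Differentiability.
Variable R : realType.
Notation nc := (@Normc.normc R).

(** Continuity of [f] at [z], with the modulus taken in [R] *)
Definition ccont (f : R[i] -> R[i]) (z : R[i]) :=
  forall e : R, 0 < e -> exists2 d : R, 0 < d &
    forall w, nc (w - z) < d -> nc (f w - f z) <= e.

(** [f] has complex derivative [l] at [z]: first-order expansion form, without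
    division *)
Definition cdiff (f : R[i] -> R[i]) (z l : R[i]) :=
  forall e : R, 0 < e -> exists2 d : R, 0 < d &
    forall w, nc (w - z) < d ->
      nc (f w - f z - l * (w - z)) <= e * nc (w - z).

Lemma ball_nc (z w : R[i]^o) (d : R) : ball z d%:C w = (nc (w - z) < d) :> Prop.
Proof. by rewrite /ball /= norm_nc ltcR ncC. Qed.

Lemma ccontP (f : R[i] -> R[i]) z :
  {for z, continuous (f : R[i]^o -> R[i]^o)} <-> ccont f z.
Proof.
split => [fz e e0|fz].
  have /cvgrPdist_le/(_ e%:C) := fz; rewrite ltcR => /(_ e0).
  move=> /nbhs_ballP[d' /= /posC[d d0 ->]] H; exists d; first exact: d0.
  move=> w wz; have : ball (z : R[i]^o) d%:C w by rewrite ball_nc.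
  by move=> /H; rewrite /= norm_nc lecR ncC.
have FF : Filter (nbhs (z : R[i]^o)) by exact: nbhs_filter.
apply/(cvgrPdist_le (FF := FF)) => e' /posC[e e0 ->].
have [d d0 H] := fz e e0; apply/nbhs_ballP; exists d%:C => /=.
  by rewrite ltcR.
move=> w; rewrite ball_nc => wz /=.
by rewrite norm_nc lecR ncC; exact: H.
Qed.

Lemma cdiff_derivable (f : R[i] -> R[i]) z :
  derivable (f : R[i]^o -> R[i]^o) z 1 <-> exists l, cdiff f z l.
Proof.
split=> [/cvg_ex[/= l /cvgrPdist_le H]|[l H]].
  exists l => e e0; have := H e%:C; rewrite ltcR => /(_ e0).
  move=> /nbhs_ballP[d' /= /posC[d d0 ->]] {}H; exists d; first exact: d0.
  move=> w wz; have [->|wz0] := eqVneq w z.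
    by rewrite !subrr mulr0 subr0 Normc.normc0 mulr0.
  have wz1 : w - z != 0 by rewrite subr_eq0.
  have : ball (0 : R[i]^o) d%:C (w - z) by rewrite ball_nc subr0.
  move=> /H /(_ wz1); rewrite /= norm_nc lecR /GRing.scale /= mulr1 subrK => {}H.
  have -> : f w - f z - l * (w - z) = - (l - (w - z)^-1 * (f w - f z)) * (w - z).
    by field.
  by rewrite Normc.normcM ncN ler_wpM2r// nc_ge0.
apply/cvg_ex; exists l; apply/cvgrPdist_le => e' /posC[e e0 ->].
have [d d0 {}H] := H e e0; apply/nbhs_ballP; exists d%:C => /=.
  by rewrite ltcR.
move=> w; rewrite ball_nc subr0 => wd w0 /=.
rewrite norm_nc lecR /GRing.scale /= mulr1.
have := H (w + z); rewrite addrK => /(_ wd).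
have -> : f (w + z) - f z - l * w = - (l - w^-1 * (f (w + z) - f z)) * w.
  by field.
by rewrite Normc.normcM ncN ler_pM2r// nc_gt0.
Qed.

Lemma cdiff_ccont (f : R[i] -> R[i]) z l : cdiff f z l -> ccont f z.
Proof.
move=> fl; apply/ccontP; apply: differentiable_continuous.
by apply/derivable1_diffP/cdiff_derivable; exists l.
Qed.

End Differentiability.

(** * Extrema, curves and primitives *)

Section RealTools.
Variable R : realType.
Notation nc := (@Normc.normc R).
Implicit Types (u : R[i] -> R).

(** Continuity at [z] of a real function on the plane *)
Definition ucont u (z : R[i]) :=
  forall e : R, 0 < e -> exists2 d : R, 0 < d &
    forall w, nc (w - z) < d -> `|u w - u z| <= e.

Lemma ucont_prod u (p : R * R) : ucont u (p.1 +i* p.2) ->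
  {for p, continuous (fun q : R * R => u (q.1 +i* q.2))}.
Proof.
case: p => a b /= ucz; apply/cvgrPdist_le => e e0.
have [d d0 H] := ucz e e0.
have d2 : 0 < d / 2 by rewrite divr_gt0.
exists (ball a (d / 2), ball b (d / 2)) => /=.
  by split; exact: nbhsx_ballx.
move=> [x y] [/= xa yb].
rewrite distrC; apply: H; apply: le_lt_trans (nc_le_ReIm _) _ => /=.
by rewrite (splitr d) ltrD// distrC.
Qed.

Lemma ucont_nc c z : ucont (fun w => nc (w - c)) z.
Proof.
move=> e e0; exists e => // w wz; rewrite ler_norml.
have := ncB (w - c) (z - c); have := ncB (z - c) (w - c).
have -> : w - c - (z - c) = w - z by ring.
have -> : z - c - (w - c) = - (w - z) by ring.
rewrite ncN; lra.
Qed.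

(** Extreme values on a closed annulus; [r' = 0] gives the closed disc, and
    [r' = r] the circle. *)
Lemma evt_annulus u c (r' r : R) (z0 : R[i]) : r' <= nc (z0 - c) <= r ->
  (forall z, r' <= nc (z - c) <= r -> ucont u z) ->
  exists2 a, r' <= nc (a - c) <= r &
    forall z, r' <= nc (z - c) <= r -> u z <= u a.
Proof.
move=> z0E uc.
pose m (q : R * R) := nc (q.1 +i* q.2 - c).
pose A := [set q | m q <= r] `&` [set q | r' <= m q].
have mc : continuous m.
  by move=> q; apply: (@ucont_prod (fun w => nc (w - c))); exact: ucont_nc.
have Acl : closed A.
  by apply: closedI; [exact: (preimage_closed (D := [set x | x <= r]))
                     |exact: (preimage_closed (D := [set x | r' <= x]))].
pose B := `[complex.Re c - r, complex.Re c + r] `*`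
          `[complex.Im c - r, complex.Im c + r].
have AB : A `<=` B.
  move=> [x y] [/= h _]; have := le_trans (normRe _) h.
  have := le_trans (normIm _) h; rewrite ImB ReB /= !ler_norml => h1 h2.
  by split; rewrite /= in_itv /=; lra.
have cA : compact A.
  apply: subclosed_compact Acl _ AB.
  by apply: compact_setX; exact: segment_compact.
have cxE z : complex.Re z +i* complex.Im z = z by case: z.
have zA z : r' <= nc (z - c) <= r -> A (complex.Re z, complex.Im z).
  by move=> /andP[h1 h2]; split; rewrite /= /m /= cxE.
have [] := @compact_EVT_max _ _ (fun q : R * R => u (q.1 +i* q.2)) A _ cA _.
- by exists (complex.Re z0, complex.Im z0); exact: zA.
- apply: continuous_in_subspaceT => q; rewrite inE => -[h1 h2].
  by apply: ucont_prod; apply: uc; apply/andP; split.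
move=> [x y]; rewrite inE => -[/= h1 h2] H; exists (x +i* y).
  by apply/andP.
move=> z /zA/mem_set/H /=; by rewrite cxE.
Qed.

(** The curve [P] in the plane has velocity [l] at time [x]. *)
Definition rdiff (P : R -> R[i]) (x : R) (l : R[i]) :=
  forall e : R, 0 < e -> exists2 d : R, 0 < d &
    forall y, `|y - x| < d ->
      nc (P y - P x - l * (y - x)%:C) <= e * `|y - x|.

Lemma is_derive_eps (f : R -> R) (x l : R) : is_derive x (1 : R) f l <->
  forall e : R, 0 < e -> exists2 d : R, 0 < d &
    forall y, `|y - x| < d -> `|f y - f x - l * (y - x)| <= e * `|y - x|.
Proof.
split=> [fl e e0|H].
  have /cvg_ex[/= l' H'] := @ex_derive _ _ _ _ _ _ _ fl.
  have l'E : l' = l.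
    by rewrite -(@derive_val _ _ _ _ _ _ _ fl) /derive; apply/esym/cvg_lim.
  move: H'; rewrite {}l'E => /cvgrPdist_le/(_ e e0)/nbhs_ballP[d /= d0 H].
  exists d => // y yx; have [->|yx0] := eqVneq y x.
    by rewrite !subrr mulr0 subr0 normr0 mulr0.
  have yx1 : y - x != 0 by rewrite subr_eq0.
  have := H (y - x); rewrite /ball /= sub0r normrN => /(_ yx yx1).
  rewrite /GRing.scale /= mulr1 subrK.
  have -> : f y - f x - l * (y - x) = - (l - (y - x)^-1 * (f y - f x)) * (y - x).
    by field.
  by rewrite normrM normrN => {}H; rewrite ler_wpM2r.
have {}H : h^-1 *: ((f \o shift x) (h *: (1 : R)) - f x) @[h --> 0^'] --> l.
  apply/cvgrPdist_le => e e0; have [d d0 {}H] := H e e0.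
  apply/nbhs_ballP; exists d => //= h; rewrite /ball /= sub0r normrN => hd h0.
  rewrite /GRing.scale /= mulr1.
  have := H (h + x); rewrite addrK => /(_ hd).
  have -> : f (h + x) - f x - l * h = - (l - h^-1 * (f (h + x) - f x)) * h.
    by field.
  by rewrite normrM normrN ler_pM2r// normr_gt0.
by apply: DeriveDef; [apply/cvg_ex; exists l | exact/cvg_lim].
Qed.

Lemma rdiff_Re P x l : rdiff P x l ->
  is_derive x (1 : R) (fun t => complex.Re (P t)) (complex.Re l).
Proof.
move=> Pl; apply/is_derive_eps => e e0; have [d d0 H] := Pl e e0.
exists d => // y /H; apply: le_trans; apply: le_trans (normRe _).
rewrite !ReB le_eqVlt; apply/orP; left; apply/eqP; congr `|_ - _|.
by case: (l) => ? ?; rewrite /= mulr0 subr0.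
Qed.

Lemma rdiff_Im P x l : rdiff P x l ->
  is_derive x (1 : R) (fun t => complex.Im (P t)) (complex.Im l).
Proof.
move=> Pl; apply/is_derive_eps => e e0; have [d d0 H] := Pl e e0.
exists d => // y /H; apply: le_trans; apply: le_trans (normIm _).
rewrite !ImB le_eqVlt; apply/orP; left; apply/eqP; congr `|_ - _|.
by case: (l) => ? ?; rewrite /= mulr0 add0r.
Qed.

Lemma rdiff_ReIm (P : R -> R[i]) x l :
  is_derive x (1 : R) (fun t => complex.Re (P t)) (complex.Re l) ->
  is_derive x (1 : R) (fun t => complex.Im (P t)) (complex.Im l) ->
  rdiff P x l.
Proof.
move=> /is_derive_eps dr /is_derive_eps di e e0.
have e2 : 0 < e / 2 by rewrite divr_gt0.
have [d1 d10 H1] := dr _ e2; have [d2 d20 H2] := di _ e2.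
exists (Num.min d1 d2); first by rewrite lt_min d10.
move=> y; rewrite lt_min => /andP[/H1 {}H1 /H2 {}H2].
apply: le_trans (nc_le_ReIm _) _.
have -> : complex.Re (P y - P x - l * (y - x)%:C) =
  complex.Re (P y) - complex.Re (P x) - complex.Re l * (y - x).
  by rewrite !ReB; case: (l) => ? ?; rewrite /= mulr0 subr0.
have -> : complex.Im (P y - P x - l * (y - x)%:C) =
  complex.Im (P y) - complex.Im (P x) - complex.Im l * (y - x).
  by rewrite !ImB; case: (l) => ? ?; rewrite /= mulr0 add0r.
lra.
Qed.

Lemma rdiffB P Q x l m : rdiff P x l -> rdiff Q x m ->
  rdiff (fun t => P t - Q t) x (l - m).
Proof.
move=> dP dQ e e0; have e2 : 0 < e / 2 by rewrite divr_gt0.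
have [d1 d10 H1] := dP _ e2; have [d2 d20 H2] := dQ _ e2.
exists (Num.min d1 d2); first by rewrite lt_min d10.
move=> y; rewrite lt_min => /andP[/H1 {}H1 /H2 {}H2].
have -> : P y - Q y - (P x - Q x) - (l - m) * (y - x)%:C =
 (P y - P x - l * (y - x)%:C) - (Q y - Q x - m * (y - x)%:C) by ring.
apply: le_trans (ncD _ _) _; rewrite ncN; lra.
Qed.

Lemma real_mvt (f df : R -> R) (a b : R) : a < b ->
  (forall x, a <= x <= b -> is_derive x (1 : R) f (df x)) ->
  exists2 c, a <= c <= b & f b - f a = df c * (b - a).
Proof.
move=> ab H; have [||c] := @MVT R f df a b ab.
- by move=> x; rewrite in_itv /= => /andP[ax xb]; apply: H; rewrite !ltW.
- apply: derivable_within_continuous => x; rewrite in_itv /= => /H fx.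
  exact: ex_derive.
by rewrite in_itv /= => /andP[ac cb] e; exists c => //; rewrite !ltW.
Qed.

Lemma rdiff_bound_lt (P p : R -> R[i]) a b B : a < b ->
  (forall x, a <= x <= b -> rdiff P x (p x)) ->
  (forall x, a <= x <= b -> nc (p x) <= B) ->
  nc (P b - P a) <= 2 * B * (b - a).
Proof.
move=> ab dP pB; apply: le_trans (nc_le_ReIm _) _.
have [x xab e1] := real_mvt ab (fun x xab => rdiff_Re (dP x xab)).
have [y yab e2] := real_mvt ab (fun x xab => rdiff_Im (dP x xab)).
have ba : 0 < b - a by rewrite subr_gt0.
rewrite ReB ImB e1 e2 !normrM (gtr0_norm ba).
have h1 := le_trans (normRe _) (pB x xab).
have h2 := le_trans (normIm _) (pB y yab).
nra.
Qed.

(** Mean value inequality; the constant 2 comes from treating the real and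
    imaginary parts separately. *)
Lemma rdiff_bound (P p : R -> R[i]) a b B :
  (forall x, Num.min a b <= x <= Num.max a b -> rdiff P x (p x)) ->
  (forall x, Num.min a b <= x <= Num.max a b -> nc (p x) <= B) ->
  nc (P b - P a) <= 2 * B * `|b - a|.
Proof.
have [ab|ba|<-] := ltgtP a b.
- move=> dP pB.
  by rewrite gtr0_norm ?subr_gt0//; exact: rdiff_bound_lt dP pB.
- move=> dP pB; rewrite ltr0_norm ?subr_lt0// opprB ncC.
  exact: rdiff_bound_lt dP pB.
by rewrite !subrr Normc.normc0 normr0 mulr0.
Qed.

(** Only [x > - A] is covered because the primitive is an integral from [- A];
    [A] is arbitrary. *)
Lemma real_primitive (c : R -> R) (A : R) : continuous c ->
  exists P : R -> R, forall x, - A < x -> is_derive x (1 : R) P (c x).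
Proof.
move=> cc.
pose P x := \int[lebesgue_measure]_(t in [set` Interval (BLeft (- A)) (BRight x)]) c t.
exists P => x Ax.
have xx1 : x < x + 1 by rewrite ltrDl.
have ci : lebesgue_measure.-integrable
    [set` Interval (BLeft (- A)) (BRight (x + 1))] (EFin \o c).
  apply: continuous_compact_integrable; first exact: segment_compact.
  exact: continuous_subspaceT.
have [|dP eP] := continuous_FTC1 xx1 ci _ (cc x).
  by rewrite lte_fin.
apply: DeriveDef; first exact: dP.
by rewrite -derive1E; exact: eP.
Qed.

Lemma curve_primitive (c : R -> R[i]) (A : R) :
  (forall x e, 0 < e -> exists2 d : R, 0 < d &
     forall y, `|y - x| < d -> nc (c y - c x) <= e) ->
  exists P : R -> R[i], forall x, - A < x -> rdiff P x (c x).
Proof.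
move=> cc.
have c1 : continuous (fun x => complex.Re (c x)).
  move=> x; apply/cvgrPdist_le => e e0; have [d d0 H] := cc x e e0.
  apply/nbhs_ballP; exists d => // y /= yx.
  rewrite distrC -ReB; apply: le_trans (normRe _) _; apply: H.
  by rewrite distrC.
have c2 : continuous (fun x => complex.Im (c x)).
  move=> x; apply/cvgrPdist_le => e e0; have [d d0 H] := cc x e e0.
  apply/nbhs_ballP; exists d => // y /= yx.
  rewrite distrC -ImB; apply: le_trans (normIm _) _; apply: H.
  by rewrite distrC.
have [P1 H1] := real_primitive A c1; have [P2 H2] := real_primitive A c2.
exists (fun x => P1 x +i* P2 x) => x Ax.
by apply: rdiff_ReIm => /=; [exact: H1|exact: H2].
Qed.

End RealTools.

(** * Goursat's theorem on rectangles *)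

Section Goursat.
Variable R : realType.
Notation nc := (@Normc.normc R).

Lemma rdiffZ (m : R[i]) (P : R -> R[i]) x l :
  rdiff P x l -> rdiff (fun t => m * P t) x (m * l).
Proof.
move=> dP e e0; have m1 : 0 < nc m + 1 by rewrite ltr_wpDl ?nc_ge0.
have [|d d0 H] := dP (e / (nc m + 1)); first by rewrite divr_gt0.
exists d => // y /H {}H.
have -> : m * P y - m * P x - m * l * (y - x)%:C =
  m * (P y - P x - l * (y - x)%:C) by ring.
rewrite Normc.normcM; apply: (@le_trans _ _ ((nc m + 1) * (e / (nc m + 1) * `|y - x|))).
  by apply: ler_pM; rewrite ?nc_ge0// lerDl.
rewrite le_eqVlt; apply/orP; left; apply/eqP; field; exact: lt0r_neq0.
Qed.

Lemma cdiff_line (F : R[i] -> R[i]) (z0 v : R[i]) (t : R) l :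
  cdiff F (z0 + v * t%:C) l ->
  rdiff (fun s => F (z0 + v * s%:C)) t (l * v).
Proof.
move=> dF e e0; have v1 : 0 < nc v + 1 by rewrite ltr_wpDl ?nc_ge0.
have [|d d0 H] := dF (e / (nc v + 1)); first by rewrite divr_gt0.
exists (d / (nc v + 1)) => [|s st]; first by rewrite divr_gt0.
have sE : z0 + v * s%:C - (z0 + v * t%:C) = v * (s - t)%:C.
  by rewrite rmorphB /=; ring.
have nsE : nc (v * (s - t)%:C) <= (nc v + 1) * `|s - t|.
  by rewrite Normc.normcM nc_real ler_wpM2r// lerDl.
have := H (z0 + v * s%:C); rewrite sE mulrA => {}H.
apply: le_trans (H _) _.
  by apply: le_lt_trans nsE _; rewrite mulrC -ltr_pdivlMr.
rewrite mulrAC ler_pdivrMr// -mulrA ler_pM2l//.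
by rewrite [leRHS]mulrC.
Qed.

Lemma cartC (x y : R) : x +i* y = x%:C + 'i * y%:C.
Proof. by apply: ReIm_eq => /=; ring. Qed.

Lemma cdiff_horizontal (F : R[i] -> R[i]) (x y : R) l :
  cdiff F (x +i* y) l -> rdiff (fun s => F (s +i* y)) x l.
Proof.
move=> dF; have -> : (fun s => F (s +i* y)) =
    (fun s => F ('i * y%:C + 1 * s%:C)).
  by apply/funext => s; congr F; rewrite cartC mul1r addrC.
rewrite -[l]mulr1; apply: cdiff_line.
by rewrite mul1r addrC -cartC.
Qed.

Lemma cdiff_vertical (F : R[i] -> R[i]) (x y : R) l :
  cdiff F (x +i* y) l -> rdiff (fun s => F (x +i* s)) y (l * 'i).
Proof.
move=> dF; have -> : (fun s => F (x +i* s)) =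
    (fun s => F (x%:C + 'i * s%:C)).
  by apply/funext => s; rewrite cartC.
by apply: cdiff_line; rewrite -cartC.
Qed.

Lemma nc2 : nc 2 = 2 :> R.
Proof. by rewrite (_ : 2 = 2%:C) ?nc_real ?ger0_norm// rmorphMn. Qed.

Lemma nci z : nc ('i * z) = nc z.
Proof. by rewrite Normc.normcM /= expr0n /= expr1n add0r sqrtr1 mul1r. Qed.

Lemma cdiff_quadratic (c l p z : R[i]) :
  cdiff (fun w => c * w + l * (w - p) ^+ 2 / 2) z (c + l * (z - p)).
Proof.
move=> e e0; have l1 : 0 < nc l + 1 by rewrite ltr_wpDl ?nc_ge0.
exists (e / (nc l + 1)) => [|w wz]; first by rewrite divr_gt0.
have -> : c * w + l * (w - p) ^+ 2 / 2 - (c * z + l * (z - p) ^+ 2 / 2)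
  - (c + l * (z - p)) * (w - z) = l * (w - z) / 2 * (w - z) by field.
rewrite Normc.normcM ler_wpM2r ?nc_ge0//.
have e1 : nc l * nc (w - z) <= e.
  apply: (@le_trans _ _ ((nc l + 1) * nc (w - z))).
    by rewrite ler_wpM2r ?nc_ge0// lerDl.
  by rewrite mulrC -ler_pdivlMr// ltW.
rewrite !Normc.normcM Normc.normcV nc2.
have := nc_ge0 l; have := nc_ge0 (w - z); nra.
Qed.

(** Nested intervals whose lengths are halved at each step have a common
    point. *)
Lemma nested_point (u : nat -> R) (w : R) : 0 <= w ->
  (forall n, u n <= u n.+1 <= u n + w / 2 ^+ n.+1) ->
  exists p, forall n, u n <= p <= u n + w / 2 ^+ n.
Proof.
move=> w0 H.
have up n k : u n <= u (n + k)%N.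
  elim: k => [|k IH]; first by rewrite addn0.
  by rewrite addnS; apply: le_trans IH _; case/andP: (H (n + k)%N).
have dn n k : u (n + k)%N + w / 2 ^+ (n + k) <= u n + w / 2 ^+ n.
  elim: k => [|k IH]; first by rewrite addn0.
  rewrite addnS; apply: le_trans IH; case/andP: (H (n + k)%N) => _ h.
  have -> : w / 2 ^+ (n + k) = w / 2 ^+ (n + k).+1 + w / 2 ^+ (n + k).+1.
    by rewrite exprS; field.
  lra.
have wn n : 0 <= w / 2 ^+ n by rewrite divr_ge0// exprn_ge0.
have ub n m : u m <= u n + w / 2 ^+ n.
  apply: le_trans (dn n m); apply: le_trans (_ : u (n + m)%N <= _).
    by rewrite addnC.
  by rewrite lerDl.
have hs : has_sup (range u).
  by split; [exists (u 0); exists 0%N | exists (u 0 + w / 2 ^+ 0) => _ [m _ <-]].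
exists (sup (range u)) => n; apply/andP; split.
  by apply: sup_upper_bound => //; exists n.
by apply: ge_sup; [case: hs | move=> _ [m _ <-]].
Qed.

Section Rectangle.
(* [X y] and [Y x] are primitives of [f] along the horizontal line at height
   [y] and along the vertical line at abscissa [x]. *)
Variables (f : R[i] -> R[i]) (A : R) (X Y : R -> R -> R[i]).
Let inA (x : R) := - A <= x <= A.
Hypothesis A0 : 0 < A.
Hypothesis f_diff : forall x y, inA x -> inA y -> exists l, cdiff f (x +i* y) l.
Hypothesis X_diff : forall y x, inA x -> inA y -> rdiff (X y) x (f (x +i* y)).
Hypothesis Y_diff : forall x y, inA x -> inA y -> rdiff (Y x) y (f (x +i* y)).

(** The integral of [f] along the boundary of the rectangle with lower left
    corner [x +i* y], width [w] and height [h] *)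
Let E (x y w h : R) : R[i] :=
  X y (x + w) - X y x + 'i * (Y (x + w) (y + h) - Y (x + w) y)
  - (X (y + h) (x + w) - X (y + h) x) - 'i * (Y x (y + h) - Y x y).

(** If [f] is within [B] of an affine function on the rectangle, then its
    contour integral is at most [2 B] times the perimeter, the affine function
    contributing nothing. *)
Lemma contour_affine (x y w h B : R) (p l c : R[i]) : 0 <= w -> 0 <= h ->
  inA x -> inA y -> inA (x + w) -> inA (y + h) ->
  (forall s t, x <= s <= x + w -> y <= t <= y + h ->
     nc (f (s +i* t) - (c + l * (s +i* t - p))) <= B) ->
  nc (E x y w h) <= 4 * B * (w + h).
Proof.
move=> w0 h0 xA yA xwA yhA HB.
(* [Q] is a primitive of the affine function [L] in both directions. *)
pose L z : R[i] := c + l * (z - p).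
pose Q z : R[i] := c * z + l * (z - p) ^+ 2 / 2.
have dQ z : cdiff Q z (L z) by exact: cdiff_quadratic.
have hX t : inA t -> y <= t <= y + h ->
    nc (X t (x + w) - Q ((x + w) +i* t) - (X t x - Q (x +i* t))) <= 2 * B * w.
  move=> tA ty; have ww : w = `|x + w - x| by rewrite addrAC subrr add0r ger0_norm.
  rewrite {3}ww.
  apply: (@rdiff_bound _ (fun s => X t s - Q (s +i* t))
           (fun s => f (s +i* t) - L (s +i* t))) => s.
    rewrite min_l ?lerDl// max_r ?lerDl// => /andP[s1 s2].
    apply: rdiffB; last exact: cdiff_horizontal.
    by apply: X_diff => //; move: xA xwA; rewrite /inA; lra.
  rewrite min_l ?lerDl// max_r ?lerDl// => sx; exact: HB.
have hY s : inA s -> x <= s <= x + w ->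
    nc (Y s (y + h) - - 'i * Q (s +i* (y + h)) - (Y s y - - 'i * Q (s +i* y)))
      <= 2 * B * h.
  move=> sA sx; have hh : h = `|y + h - y| by rewrite addrAC subrr add0r ger0_norm.
  rewrite {3}hh.
  apply: (@rdiff_bound _ (fun t => Y s t - - 'i * Q (s +i* t))
           (fun t => f (s +i* t) - L (s +i* t))) => t.
    rewrite min_l ?lerDl// max_r ?lerDl// => /andP[t1 t2].
    apply: rdiffB; first by apply: Y_diff => //; move: yA yhA; rewrite /inA; lra.
    have -> : L (s +i* t) = - 'i * (L (s +i* t) * 'i).
      by rewrite mulrCA mulNr -expr2 sqr_i opprK mulr1.
    by apply: rdiffZ; exact: cdiff_vertical.
  rewrite min_l ?lerDl// max_r ?lerDl// => ty; exact: HB.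
have y_in : y <= y <= y + h by rewrite lexx lerDl.
have yh_in : y <= y + h <= y + h by rewrite lexx lerDl h0.
have x_in : x <= x <= x + w by rewrite lexx lerDl.
have xw_in : x <= x + w <= x + w by rewrite lexx lerDl w0.
have := hX _ yA y_in; have := hX _ yhA yh_in.
have := hY _ xA x_in; have := hY _ xwA xw_in.
set a1 := nc _; set a2 := nc _; set a3 := nc _; set a4 := nc _.
move=> h1 h2 h3 h4; apply: (@le_trans _ _ (a4 + a1 + a3 + a2)); last lra.
rewrite /a1 /a2 /a3 /a4 -(nci (Y _ _ - _ - _)) -(nci (Y x _ - _ - _)).
rewrite -[nc (X (y + h) _ - _ - _)]ncN -[nc ('i * (Y x _ - _ - _))]ncN.
apply: le_trans; last first.
  apply: lerD; last exact: lexx.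
  apply: lerD; last exact: lexx.
  exact: ncD.
apply: le_trans; last first.
  apply: lerD; last exact: lexx.
  exact: ncD.
apply: le_trans; last exact: ncD.
rewrite le_eqVlt; apply/orP; left; apply/eqP; congr nc.
have ii q : 'i * (- 'i * q) = q :> R[i].
  by rewrite mulrA mulrN -expr2 sqr_i opprK mul1r.
by rewrite /E !mulrBr !ii; ring.
Qed.

Lemma contour_split (x y w h : R) : E x y w h =
  E x y (w / 2) (h / 2) + E (x + w / 2) y (w / 2) (h / 2)
  + E x (y + h / 2) (w / 2) (h / 2) + E (x + w / 2) (y + h / 2) (w / 2) (h / 2).
Proof.
rewrite /E.
have -> : x + w / 2 + w / 2 = x + w by field.
have -> : y + h / 2 + h / 2 = y + h by field.
ring.
Qed.

(** Some quarter of the rectangle carries at least a quarter of the modulus of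
    the integral; near the limit point of the nested quarters, [f] is affine up
    to o(size). *)
Lemma contour_eq0 (x y w h : R) : 0 <= w -> 0 <= h ->
  inA x -> inA y -> inA (x + w) -> inA (y + h) -> E x y w h = 0.
Proof.
move=> w0 h0 xA yA xwA yhA.
have step (q : R * R * nat) : exists s : R * R,
    [/\ q.1.1 <= s.1 <= q.1.1 + w / 2 ^+ q.2.+1,
        q.1.2 <= s.2 <= q.1.2 + h / 2 ^+ q.2.+1 &
        nc (E q.1.1 q.1.2 (w / 2 ^+ q.2) (h / 2 ^+ q.2)) <=
        4 * nc (E s.1 s.2 (w / 2 ^+ q.2.+1) (h / 2 ^+ q.2.+1))].
  case: q => [[a b] n] /=.
  have hw m : 0 <= w / 2 ^+ m by rewrite divr_ge0// exprn_ge0.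
  have hh m : 0 <= h / 2 ^+ m by rewrite divr_ge0// exprn_ge0.
  rewrite contour_split.
  have -> : w / 2 ^+ n / 2 = w / 2 ^+ n.+1 by rewrite exprS; field.
  have -> : h / 2 ^+ n / 2 = h / 2 ^+ n.+1 by rewrite exprS; field.
  have := hw n.+1; have := hh n.+1.
  set w' := w / _; set h' := h / _ => h'0 w'0.
  set e1 := E a b w' h'; set e2 := E (a + w') b w' h'.
  set e3 := E a (b + h') w' h'; set e4 := E (a + w') (b + h') w' h'.
  have := ncD (e1 + e2 + e3) e4; have := ncD (e1 + e2) e3; have := ncD e1 e2.
  move=> n1 n2 n3.
  have [k1|k1] := leP (nc (e1 + e2 + e3 + e4)) (4 * nc e1).
    by exists (a, b) => /=; split => //; rewrite lexx lerDl.
  have [k2|k2] := leP (nc (e1 + e2 + e3 + e4)) (4 * nc e2).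
    by exists (a + w', b) => /=; split => //; rewrite lexx lerDl ?andbT.
  have [k3|k3] := leP (nc (e1 + e2 + e3 + e4)) (4 * nc e3).
    by exists (a, b + h') => /=; split => //; rewrite lexx lerDl ?andbT.
  exists (a + w', b + h') => /=; split; rewrite ?lexx ?lerDl ?andbT//.
  rewrite -/e4; lra.
have [g gP] := choice step.
pose S := fix S n := if n is m.+1 then g (S m, m) else (x, y).
have Sx n : (S n).1 <= (S n.+1).1 <= (S n).1 + w / 2 ^+ n.+1.
  by case: (gP (S n, n)).
have Sy n : (S n).2 <= (S n.+1).2 <= (S n).2 + h / 2 ^+ n.+1.
  by case: (gP (S n, n)).
have SE n : nc (E x y w h) <=
    4 ^+ n * nc (E (S n).1 (S n).2 (w / 2 ^+ n) (h / 2 ^+ n)).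
  elim: n => [|n IH]; first by rewrite !expr0 !divr1 mul1r.
  apply: le_trans IH _; rewrite [4 ^+ n.+1]exprSr -mulrA ler_wpM2l ?exprn_ge0//.
  by case: (gP (S n, n)).
have [p pP] := nested_point w0 Sx; have [q qP] := nested_point h0 Sy.
have Sin n : [/\ x <= (S n).1, (S n).1 + w / 2 ^+ n <= x + w,
                 y <= (S n).2 & (S n).2 + h / 2 ^+ n <= y + h].
  elim: n => [|n [i1 i2 i3 i4]]; first by rewrite /= expr0 !divr1 !lexx.
  have /andP[j1 j2] := Sx n; have /andP[j3 j4] := Sy n.
  have w2 : w / 2 ^+ n = w / 2 ^+ n.+1 + w / 2 ^+ n.+1 by rewrite exprS; field.
  have h2 : h / 2 ^+ n = h / 2 ^+ n.+1 + h / 2 ^+ n.+1 by rewrite exprS; field.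
  by split; lra.
have pA : inA p.
  have := pP 0%N; rewrite expr0 divr1 /= => pp.
  by move: xA xwA; rewrite /inA; lra.
have qA : inA q.
  have := qP 0%N; rewrite expr0 divr1 /= => qq.
  by move: yA yhA; rewrite /inA; lra.
have [l dl] := f_diff pA qA.
(* The factor [4 ^+ n] lost in [n] bisections is compensated by the area of
   the quarter, and an arbitrary factor [e] remains. *)
have bound e : 0 < e -> nc (E x y w h) <= 4 * e * (w + h) ^+ 2.
  move=> e0; have [d d0 H] := dl e e0.
  have [n nP] : exists n : nat, (w + h) / 2 ^+ n < d.
    pose m := Num.truncn ((w + h) / d).
    exists m.+1; rewrite ltr_pdivrMr ?exprn_gt0// mulrC -ltr_pdivrMr//.
    have := truncnS_gt ((w + h) / d).
    rewrite -/m => /lt_le_trans; apply.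
    by rewrite -natrX ler_nat ltnW// ltn_expl.
  have [i1 i2 i3 i4] := Sin n; have /andP[p1 p2] := pP n; have /andP[q1 q2] := qP n.
  set w' := w / 2 ^+ n in i2 p2; set h' := h / 2 ^+ n in i4 q2.
  have w'0 : 0 <= w' by rewrite divr_ge0// exprn_ge0.
  have h'0 : 0 <= h' by rewrite divr_ge0// exprn_ge0.
  have wh' : w' + h' = (w + h) / 2 ^+ n by rewrite mulrDl.
  apply: le_trans (SE n) _.
  have H4 : nc (E (S n).1 (S n).2 w' h') <= 4 * (e * (w' + h')) * (w' + h').
    apply: (@contour_affine _ _ _ _ _ (p +i* q) l (f (p +i* q))) => //;
      try by move: xA xwA yA yhA; rewrite /inA; lra.
    move=> s t s_in t_in; rewrite opprD addrA.
    have zz : nc (s +i* t - p +i* q) <= w' + h'.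
      apply: le_trans (nc_le_ReIm _) _; rewrite ReB ImB /=.
      by apply: lerD; rewrite ler_norml; lra.
    apply: le_trans (H _ _) _; first by apply: le_lt_trans zz _; rewrite wh'.
    by rewrite ler_wpM2l// ltW.
  apply: le_trans (ler_wpM2l _ H4) _; first by rewrite exprn_ge0.
  rewrite wh' (_ : 4 ^+ n = 2 ^+ n * 2 ^+ n); last first.
    by rewrite -exprMn; congr (_ ^+ _); ring.
  rewrite le_eqVlt; apply/orP; left; apply/eqP.
  by field; rewrite expf_neq0.
apply/eqP; rewrite -nc_eq0 eq_le nc_ge0 andbT.
rewrite leNgt; apply/negP => K0.
have whp : 0 < 8 * ((w + h) ^+ 2 + 1) by rewrite mulr_gt0// ltr_wpDl// sqr_ge0.
have := bound (nc (E x y w h) / (8 * ((w + h) ^+ 2 + 1))) (divr_gt0 K0 whp).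
set K := nc _ in K0 *; set W := (w + h) ^+ 2 in whp *.
have W0 : 0 <= W by rewrite sqr_ge0.
apply/negP; rewrite -ltNge.
have -> : 4 * (K / (8 * (W + 1))) * W = K * (W / (2 * (W + 1))).
  by field; rewrite lt0r_neq0// ltr_wpDl.
rewrite -[ltRHS]mulr1 ltr_pM2l// ltr_pdivrMr; lra.
Qed.

Lemma rectangle_primitive : exists F : R[i] -> R[i],
  forall x y, `|x| < A -> `|y| < A -> cdiff F (x +i* y) (f (x +i* y)).
Proof.
(* [F0] integrates along the bottom side, then upwards; [F0E] is the other way
   round, from which the derivative along the real axis is read off. *)
pose F0 x y := X (- A) x - X (- A) (- A) + 'i * (Y x y - Y x (- A)).
have F0E x y : inA x -> inA y ->
    F0 x y = X y x - X y (- A) + 'i * (Y (- A) y - Y (- A) (- A)).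
  move=> xA yA; have := @contour_eq0 (- A) (- A) (x + A) (y + A).
  have -> : - A + (x + A) = x by ring.
  have -> : - A + (y + A) = y by ring.
  have AA : inA (- A) by rewrite /inA lexx /= ge0_cp // ltW.
  have xA0 : 0 <= x + A by case/andP: xA => h _; rewrite -lerBlDr sub0r.
  have yA0 : 0 <= y + A by case/andP: yA => h _; rewrite -lerBlDr sub0r.
  move=> /(_ xA0 yA0 AA AA xA yA); rewrite /E /F0.
  have -> : - A + (x + A) = x by ring.
  have -> : - A + (y + A) = y by ring.
  move=> E0; apply/subr0_eq; rewrite -[RHS]E0; ring.
exists (fun z => F0 (complex.Re z) (complex.Im z)) => x y xA yA e e0.
have inI (a : R) : `|a| < A -> inA a.
  by rewrite ltr_norml /inA => /andP[? ?]; rewrite !ltW.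
have [l dl] := f_diff (inI _ xA) (inI _ yA).
have e4 : 0 < e / 4 by rewrite divr_gt0.
have [d d0 H] := cdiff_ccont dl e4.
pose d' := Num.min (d / 2) (Num.min (A - `|x|) (A - `|y|)).
have d'0 : 0 < d' by rewrite /d' !lt_min !subr_gt0 xA yA divr_gt0.
have [dd1 dd2 dd3] : [/\ d' <= d / 2, d' <= A - `|x| & d' <= A - `|y|].
  by rewrite /d' !ge_min !lexx !orbT.
exists d' => // -[x' y'] zz.
have hx : `|x' - x| < d' by have := le_lt_trans (normRe _) zz; rewrite ReB.
have hy : `|y' - y| < d' by have := le_lt_trans (normIm _) zz; rewrite ImB.
have x'A : `|x'| < A.
  rewrite -(subrK x x'); apply: le_lt_trans (ler_normD _ _) _; lra.
have y'A : `|y'| < A.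
  rewrite -(subrK y y'); apply: le_lt_trans (ler_normD _ _) _; lra.
change (nc (F0 x' y' - F0 x y - f (x +i* y) * (x' +i* y' - x +i* y))
        <= e * nc (x' +i* y' - x +i* y)).
have -> : F0 x' y' - F0 x y = 'i * (Y x' y' - Y x' y) + (X y x' - X y x).
  have -> : X y x' - X y x = F0 x' y - F0 x y by rewrite !F0E ?inI//; ring.
  by rewrite /F0; ring.
have dz : x' +i* y' - x +i* y = (x' - x)%:C + 'i * (y' - y)%:C.
  by apply: ReIm_eq => /=; ring.
set c := f (x +i* y) in H *.
have lin (c' : R[i]) (t a : R) : rdiff (fun s => c' * (s - a)%:C) t c'.
  move=> e' e'0; exists 1 => // s _.
  have -> : c' * (s - a)%:C - c' * (t - a)%:C - c' * (s - t)%:C = 0.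
    by rewrite !rmorphB /=; ring.
  by rewrite Normc.normc0 mulr_ge0// ltW.
have between (a b t : R) : Num.min a b <= t <= Num.max a b -> `|t - a| <= `|b - a|.
  have [ab|ba|->] := ltgtP a b => /andP[t1 t2].
  - by rewrite !ger0_norm ?subr_ge0 ?(ltW ab)//; lra.
  - by rewrite !ler0_norm ?subr_le0 ?(ltW ba)//; lra.
  - by rewrite (@le_anti _ _ t b) ?t1 ?t2.
have hX : nc (X y x' - c * (x' - x)%:C - (X y x - c * (x - x)%:C))
    <= 2 * (e / 4) * `|x' - x|.
  apply: (@rdiff_bound _ (fun s => X y s - c * (s - x)%:C)
           (fun s => f (s +i* y) - c)) => s /between sx.
    apply: rdiffB; last exact: lin.
    apply: X_diff; last exact: inI.
    apply: inI; rewrite -(subrK x s); apply: le_lt_trans (ler_normD _ _) _; lra.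
  apply: H; apply: le_lt_trans (nc_le_ReIm _) _; rewrite ReB ImB /= subrr normr0.
  lra.
have hY : nc (Y x' y' - c * (y' - y)%:C - (Y x' y - c * (y - y)%:C))
    <= 2 * (e / 4) * `|y' - y|.
  apply: (@rdiff_bound _ (fun s => Y x' s - c * (s - y)%:C)
           (fun s => f (x' +i* s) - c)) => s /between sy.
    apply: rdiffB; last exact: lin.
    apply: Y_diff; first exact: inI.
    apply: inI; rewrite -(subrK y s); apply: le_lt_trans (ler_normD _ _) _; lra.
  apply: H; apply: le_lt_trans (nc_le_ReIm _) _; rewrite ReB ImB /=.
  lra.
have nx : `|x' - x| <= nc (x' +i* y' - x +i* y).
  by have := normRe (x' +i* y' - x +i* y); rewrite ReB.
have ny : `|y' - y| <= nc (x' +i* y' - x +i* y).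
  by have := normIm (x' +i* y' - x +i* y); rewrite ImB.
move: nx ny; set n := nc (x' +i* y' - x +i* y) => nx ny.
rewrite dz.
have -> : 'i * (Y x' y' - Y x' y) + (X y x' - X y x)
    - c * ((x' - x)%:C + 'i * (y' - y)%:C) =
  'i * (Y x' y' - c * (y' - y)%:C - (Y x' y - c * (y - y)%:C)) +
  (X y x' - c * (x' - x)%:C - (X y x - c * (x - x)%:C)).
  by rewrite !subrr !mulr0; ring.
apply: le_trans (ncD _ _) _.
rewrite nci.
apply: le_trans (lerD hY hX) _.
have := ler_wpM2l (ltW e0) nx; have := ler_wpM2l (ltW e0) ny; lra.
Qed.

End Rectangle.

End Goursat.

(** * The maximum principle *)

Section MaximumPrinciple.
Variable R : realType.
Notation nc := (@Normc.normc R).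

Lemma cdiffB (f g : R[i] -> R[i]) z l m : cdiff f z l -> cdiff g z m ->
  cdiff (fun w => f w - g w) z (l - m).
Proof.
move=> df dg e e0; have e2 : 0 < e / 2 by rewrite divr_gt0.
have [d1 d10 H1] := df _ e2; have [d2 d20 H2] := dg _ e2.
exists (Num.min d1 d2); first by rewrite lt_min d10.
move=> w; rewrite lt_min => /andP[/H1 {}H1 /H2 {}H2].
have -> : f w - g w - (f z - g z) - (l - m) * (w - z) =
 (f w - f z - l * (w - z)) - (g w - g z - m * (w - z)) by ring.
apply: le_trans (ncD _ _) _; rewrite ncN; lra.
Qed.

Lemma cdiff_shift (f : R[i] -> R[i]) (a z l : R[i]) :
  cdiff f (z + a) l -> cdiff (fun w => f (w + a)) z l.
Proof.
move=> df e e0; have [d d0 H] := df e e0; exists d => // w wz.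
have wa : w + a - (z + a) = w - z by ring.
by have := H (w + a); rewrite wa => /(_ wz).
Qed.

Lemma cdiffZ (m : R[i]) (f : R[i] -> R[i]) z l :
  cdiff f z l -> cdiff (fun w => m * f w) z (m * l).
Proof.
move=> df e e0; have m1 : 0 < nc m + 1 by rewrite ltr_wpDl ?nc_ge0.
have [|d d0 H] := df (e / (nc m + 1)); first by rewrite divr_gt0.
exists d => // w /H {}H.
have -> : m * f w - m * f z - m * l * (w - z) =
  m * (f w - f z - l * (w - z)) by ring.
rewrite Normc.normcM.
apply: (@le_trans _ _ ((nc m + 1) * (e / (nc m + 1) * nc (w - z)))).
  by apply: ler_pM; rewrite ?nc_ge0// lerDl.
by rewrite mulrA mulrCA divff ?mulr1// lt0r_neq0.
Qed.

Lemma local_primitive (f : R[i] -> R[i]) (c : R[i]) (r : R) : 0 < r ->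
  (forall z, nc (z - c) < r -> exists l, cdiff f z l) ->
  exists F, exists2 A : R, 0 < A & forall z, nc (z - c) < A -> cdiff F z (f z).
Proof.
(* Clamping the coordinates to a square extends [f] continuously to the
   plane. *)
move=> r0 df; pose A := r / 4; have A0 : 0 < A by rewrite divr_gt0.
pose cl (t : R) := Num.max (- A) (Num.min t A).
have clA t : - A <= cl t <= A.
  by rewrite /cl le_max lexx /= ge_max ge_min lexx orbT ge0_cp// ltW.
have clE t : - A <= t <= A -> cl t = t.
  by move=> /andP[h1 h2]; rewrite /cl min_l// max_r.
have cl_lip s t : `|cl s - cl t| <= `|s - t|.
  have aux u v : u <= v -> cl u <= cl v <= cl u + (v - u).
    move=> uv; rewrite /cl; apply/andP; split.
      by rewrite ge_max !le_max lexx /= !le_min !ge_min uv lexx !orbT.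
    case: (leP u A) => hu; case: (leP v A) => hv;
      case: (leP (- A) u) => ku; case: (leP (- A) v) => kv;
      case: (leP (- A) A) => kA; lra.
  have [st|ts] := leP s t.
    have /andP[h1 h2] := aux _ _ st.
    by rewrite !ler0_norm ?subr_le0//; lra.
  have /andP[h1 h2] := aux _ _ (ltW ts).
  by rewrite !ger0_norm ?subr_ge0 ?(ltW ts)//; lra.
pose g z := f (z + c).
have dg x y : - A <= x <= A -> - A <= y <= A -> exists l, cdiff g (x +i* y) l.
  move=> xA yA; have [|l dl] := df (x +i* y + c); last first.
    by exists l; exact: cdiff_shift.
  rewrite addrK; apply: le_lt_trans (nc_le_ReIm _) _ => /=.
  apply: (@le_lt_trans _ _ (A + A)); first by rewrite lerD// ler_norml.
  by rewrite /A; lra.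
have gc x y e : 0 < e -> exists2 d : R, 0 < d & forall x' y',
    `|x' - x| < d -> `|y' - y| < d ->
    nc (g (cl x' +i* cl y') - g (cl x +i* cl y)) <= e.
  move=> e0; have [l dl] := dg _ _ (clA x) (clA y).
  have [d d0 H] := cdiff_ccont dl e0.
  exists (d / 2) => [|x' y' xx yy]; first by rewrite divr_gt0.
  apply: H; apply: le_lt_trans (nc_le_ReIm _) _; rewrite ReB ImB /=.
  by rewrite (splitr d); apply: ltrD; apply: le_lt_trans (cl_lip _ _) _.
have [X XP] : exists X : R -> R -> R[i], forall y x, - (A + 1) < x ->
    rdiff (X y) x (g (cl x +i* cl y)).
  have /choice[X XP] : forall y, exists P : R -> R[i], forall x, - (A + 1) < x ->
      rdiff P x (g (cl x +i* cl y)).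
    move=> y; apply: curve_primitive => x e e0.
    have [d d0 H] := gc x y e e0; exists d => // x' xx; apply: H => //.
    by rewrite subrr normr0.
  by exists X.
have [Y YP] : exists Y : R -> R -> R[i], forall x y, - (A + 1) < y ->
    rdiff (Y x) y (g (cl x +i* cl y)).
  have /choice[Y YP] : forall x, exists P : R -> R[i], forall y, - (A + 1) < y ->
      rdiff P y (g (cl x +i* cl y)).
    move=> x; apply: curve_primitive => y e e0.
    have [d d0 H] := gc x y e e0; exists d => // y' yy; apply: H => //.
    by rewrite subrr normr0.
  by exists Y.
have [F FP] : exists F : R[i] -> R[i], forall x y, `|x| < A -> `|y| < A ->
    cdiff F (x +i* y) (g (x +i* y)).
  apply: (@rectangle_primitive _ g A X Y A0 dg).
    move=> y x xA yA; have := @XP y x; rewrite !clE//; apply.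
    by case/andP: xA => h _; rewrite (lt_le_trans _ h)// ltrN2 ltrDl.
  move=> x y xA yA; have := @YP x y; rewrite !clE//; apply.
  by case/andP: yA => h _; rewrite (lt_le_trans _ h)// ltrN2 ltrDl.
exists (fun z => F (z - c)), A => // z zA; apply: cdiff_shift.
have := FP (complex.Re (z - c)) (complex.Im (z - c)).
rewrite /g (_ : _ +i* _ = z - c); last by case: (z - c).
by rewrite subrK; apply; apply: le_lt_trans zA; [exact: normRe|exact: normIm].
Qed.

(** [g] has a second-order expansion at [b]. *)
Definition taylor2 (g : R[i] -> R[i]) (b : R[i]) := exists m n : R[i],
  forall e : R, 0 < e -> exists2 d : R, 0 < d & forall h, nc h < d ->
    nc (g (b + h) - g b - m * h - n * h ^+ 2) <= e * nc h ^+ 2.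

Lemma primitive_taylor2 (F f : R[i] -> R[i]) (b l : R[i]) (r : R) : 0 < r ->
  (forall z, nc (z - b) < r -> cdiff F z (f z)) -> cdiff f b l -> taylor2 F b.
Proof.
move=> r0 dF df; exists (f b), (l / 2) => e e0.
have [|d d0 H] := df (e / 2); first by rewrite divr_gt0.
exists (Num.min d r) => [|h]; first by rewrite lt_min d0.
rewrite lt_min => /andP[hd hr].
pose Q w := f b * w + l * (w - b) ^+ 2 / 2.
have -> : F (b + h) - F b - f b * h - l / 2 * h ^+ 2 =
  (F (b + h * 1%:C) - Q (b + h * 1%:C)) - (F (b + h * 0%:C) - Q (b + h * 0%:C)).
  by rewrite /Q mulr0 mulr1 addr0; field.
have -> : e * nc h ^+ 2 = 2 * (e / 2 * nc h ^+ 2) * `|1 - 0|.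
  by rewrite subr0 normr1 mulr1; field.
apply: (@rdiff_bound _ (fun t : R => F (b + h * t%:C) - Q (b + h * t%:C))
   (fun t : R => (f (b + h * t%:C) - (f b + l * (b + h * t%:C - b))) * h)) => t.
  rewrite min_l ?ler01// max_r ?ler01// => /andP[t0 t1].
  have th : nc (h * t%:C) <= nc h.
    by rewrite Normc.normcM nc_real ger0_norm// ler_piMr// nc_ge0.
  rewrite mulrBl; apply: rdiffB; apply: cdiff_line; last exact: cdiff_quadratic.
  by apply: dF; rewrite addrAC subrr add0r; apply: le_lt_trans hr.
rewrite min_l ?ler01// max_r ?ler01// => /andP[t0 t1].
have th : nc (h * t%:C) <= nc h.
  by rewrite Normc.normcM nc_real ger0_norm// ler_piMr// nc_ge0.
rewrite Normc.normcM expr2 mulrA ler_wpM2r ?nc_ge0//.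
have := H (b + h * t%:C); rewrite opprD addrA => /(_ _).
have -> : b + h * t%:C - b = h * t%:C by ring.
move=> /(_ (le_lt_trans th hd)) /le_trans; apply.
by rewrite ler_wpM2l// divr_ge0 ?ltW.
Qed.

(** The first- and second-order terms average out over the four directions,
    since these directions, and also their squares, sum to [0]. *)
Lemma taylor2_mean (g : R[i] -> R[i]) (b : R[i]) : taylor2 g b ->
  forall e : R, 0 < e -> exists2 d : R, 0 < d & forall t, 0 < t < d ->
    4 * complex.Re (g b) - e * t ^+ 2 <=
    complex.Re (g (b + t%:C)) + complex.Re (g (b - t%:C)) +
    complex.Re (g (b + 'i * t%:C)) + complex.Re (g (b - 'i * t%:C)).
Proof.
move=> [m [n H]] e e0; have [|d d0 {}H] := H (e / 4); first by rewrite divr_gt0.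
exists d => // t /andP[t0 td].
have nt : nc t%:C = t by rewrite nc_real gtr0_norm.
have nit : nc ('i * t%:C) = t by rewrite nci.
have := H t%:C; rewrite nt => /(_ td) /(le_trans (normRe _)).
have := H (- t%:C); rewrite ncN nt => /(_ td) /(le_trans (normRe _)).
have := H ('i * t%:C); rewrite nit => /(_ td) /(le_trans (normRe _)).
have := H (- ('i * t%:C)); rewrite ncN nit => /(_ td) /(le_trans (normRe _)).
rewrite !ler_norml !ReB => /andP[h1 _] /andP[h2 _] /andP[h3 _] /andP[h4 _].
have s1 : complex.Re (m * - ('i * t%:C)) = - complex.Re (m * ('i * t%:C)).
  by rewrite mulrN; case: (m * _).
have s2 : complex.Re (m * - t%:C) = - complex.Re (m * t%:C).
  by rewrite mulrN; case: (m * _).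
have s3 : complex.Re (n * ('i * t%:C) ^+ 2) = - complex.Re (n * t%:C ^+ 2).
  by rewrite exprMn sqr_i mulN1r mulrN; case: (n * _).
move: h1 h2 h3 h4; rewrite !sqrrN s1 s2 s3; lra.
Qed.

Lemma taylor2_quotient (F : R[i] -> R[i]) (k b : R[i]) :
  taylor2 F b -> taylor2 F (b + k) ->
  taylor2 (fun z => k^-1 * (F (z + k) - F z)) b.
Proof.
move=> [m1 [n1 H1]] [m2 [n2 H2]].
exists (k^-1 * (m2 - m1)), (k^-1 * (n2 - n1)) => e e0.
have k1 : 0 < 2 * (nc k^-1 + 1) by rewrite mulr_gt0// ltr_wpDl ?nc_ge0.
have e1 : 0 < e / (2 * (nc k^-1 + 1)) by rewrite divr_gt0.
have [d1 d10 {}H1] := H1 _ e1; have [d2 d20 {}H2] := H2 _ e1.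
exists (Num.min d1 d2) => [|h]; first by rewrite lt_min d10.
rewrite lt_min => /andP[/H1 {}H1 /H2 {}H2].
have -> : k^-1 * (F (b + h + k) - F (b + h)) - k^-1 * (F (b + k) - F b) -
    k^-1 * (m2 - m1) * h - k^-1 * (n2 - n1) * h ^+ 2 =
    k^-1 * ((F (b + k + h) - F (b + k) - m2 * h - n2 * h ^+ 2) -
            (F (b + h) - F b - m1 * h - n1 * h ^+ 2)).
  by rewrite (addrAC b h k); ring.
rewrite Normc.normcM.
set E := _ - _; have nE : nc E <= 2 * (e / (2 * (nc k^-1 + 1)) * nc h ^+ 2).
  by apply: le_trans (ncD _ _) _; rewrite ncN; lra.
apply: (@le_trans _ _ ((nc k^-1 + 1) * (2 * (e / (2 * (nc k^-1 + 1)) * nc h ^+ 2)))).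
  by apply: ler_pM; rewrite ?nc_ge0// lerDl.
rewrite le_eqVlt; apply/orP; left; apply/eqP; field.
by rewrite lt0r_neq0// ltr_wpDl ?nc_ge0.
Qed.

Lemma ucontD (u v : R[i] -> R) z : ucont u z -> ucont v z ->
  ucont (fun w => u w + v w) z.
Proof.
move=> uz vz e e0; have e2 : 0 < e / 2 by rewrite divr_gt0.
have [d1 d10 H1] := uz _ e2; have [d2 d20 H2] := vz _ e2.
exists (Num.min d1 d2); first by rewrite lt_min d10.
move=> w; rewrite lt_min => /andP[/H1 {}H1 /H2 {}H2].
rewrite opprD addrACA; apply: le_trans (ler_normD _ _) _; lra.
Qed.

Lemma ucont_Re (g : R[i] -> R[i]) z :
  ccont g z -> ucont (fun w => complex.Re (g w)) z.
Proof.
move=> gz e e0; have [d d0 H] := gz e e0; exists d => // w /H.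
by rewrite -ReB; apply: le_trans (normRe _).
Qed.

Lemma ucont_sqr (a : R) (c z : R[i]) : ucont (fun w => a * nc (w - c) ^+ 2) z.
Proof.
move=> e e0; set s := nc (z - c); have s0 : 0 <= s by exact: nc_ge0.
have a1 : 0 < (`|a| + 1) * (2 * s + 1).
  by rewrite mulr_gt0 ?ltr_wpDl ?mulr_ge0.
have [|d d0 H] := @ucont_nc _ c z (Num.min 1 (e / ((`|a| + 1) * (2 * s + 1)))).
  by rewrite lt_min ltr01 divr_gt0.
exists d => // w /H; rewrite -/s le_min => /andP[h1 h2].
set t := nc (w - c) in h1 h2 *; have t0 : 0 <= t by exact: nc_ge0.
have -> : a * t ^+ 2 - a * s ^+ 2 = a * ((t - s) * (t + s)) by ring.
rewrite !normrM [`|t + s|]ger0_norm ?addr_ge0//.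
have ts : t + s <= 2 * s + 1 by have := le_trans (ler_norm _) h1; lra.
rewrite ler_pdivlMr// in h2; apply: le_trans h2.
rewrite [leRHS]mulrC -[leRHS]mulrA; apply: ler_pM => //.
- by rewrite mulr_ge0// addr_ge0.
- by rewrite lerDl.
- by rewrite [leRHS]mulrC; exact: ler_wpM2l.
Qed.

Lemma sqr_mean (b c : R[i]) (t : R) :
  nc (b + t%:C - c) ^+ 2 + nc (b - t%:C - c) ^+ 2 +
  nc (b + 'i * t%:C - c) ^+ 2 + nc (b - 'i * t%:C - c) ^+ 2 =
  4 * nc (b - c) ^+ 2 + 4 * t ^+ 2.
Proof. by rewrite !nc_sqr; case: b c => [b1 b2] [c1 c2] /=; ring. Qed.

(** The perturbed function [U = Re f + eta |z - c|^2] would be maximal at an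
    interior point [a].  Near [a], [f = F'], and [q], a difference quotient of
    [F] with small step [k], is close to [f], so that [W], which adds to [Re q]
    the term [eta |z - c|^2 - eta/2 |z - a|^2], is maximal at some [b] inside a
    small disc; but its mean over the four points at distance [t] from [b]
    exceeds [W b] by about [eta/2 t^2]. *)
Lemma max_principle_Re (f : R[i] -> R[i]) (c : R[i]) (r M : R) :
  (forall z, nc (z - c) <= r -> exists l, cdiff f z l) ->
  (forall z, nc (z - c) = r -> complex.Re (f z) <= M) ->
  forall z, nc (z - c) <= r -> complex.Re (f z) <= M.
Proof.
move=> df fM z0 z0r; rewrite leNgt; apply/negP => fz0.
have r_ge0 : 0 <= r by exact: le_trans (nc_ge0 _) z0r.
pose eta := (complex.Re (f z0) - M) / (2 * (r ^+ 2 + 1)).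
have r1 : 0 < r ^+ 2 + 1 by rewrite ltr_wpDl ?sqr_ge0.
have eta0 : 0 < eta by rewrite divr_gt0 ?subr_gt0// mulr_gt0.
have etaM : eta * r ^+ 2 < complex.Re (f z0) - M.
  have -> : complex.Re (f z0) - M = eta * (2 * (r ^+ 2 + 1)).
    by rewrite /eta divfK// mulf_neq0// lt0r_neq0.
  rewrite ltr_pM2l//; lra.
pose U z := complex.Re (f z) + eta * nc (z - c) ^+ 2.
have [||a] := @evt_annulus _ U c 0 r z0.
- by rewrite nc_ge0.
- move=> z /andP[_ zr]; have [l dl] := df z zr.
  by apply: ucontD (ucont_sqr _ _ _); apply: ucont_Re; exact: cdiff_ccont dl.
rewrite nc_ge0 /= => ar aU.
have Umax z : nc (z - c) <= r -> U z <= U a.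
  by move=> zr; apply: aU; rewrite nc_ge0.
have {ar} ar : nc (a - c) < r.
  rewrite lt_neqAle ar andbT; apply/eqP => ae.
  have := Umax _ z0r; rewrite /U ae; have := fM _ ae.
  have : 0 <= eta * nc (z0 - c) ^+ 2 by rewrite mulr_ge0 ?sqr_ge0// ltW.
  lra.
have [|z|F [A A0 FA]] := @local_primitive f a (r - nc (a - c)).
- by rewrite subr_gt0.
- move=> za; apply: df; rewrite -(subrK a z) -addrA.
  by apply: le_trans (ncD _ _) _; lra.
pose rho := Num.min A (r - nc (a - c)) / 2.
have rho0 : 0 < rho by rewrite divr_gt0// lt_min A0 subr_gt0.
have [rhoA rhor] : 2 * rho <= A /\ 2 * rho <= r - nc (a - c).
  by rewrite /rho mulrC divfK// !ge_min !lexx orbT.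
have za_r z : nc (z - a) <= 2 * rho -> nc (z - c) <= r.
  move=> za; rewrite -(subrK a z) -addrA.
  by apply: le_trans (ncD _ _) _; lra.
have er0 : 0 < eta * rho ^+ 2 / 8 by rewrite divr_gt0// mulr_gt0// exprn_gt0.
have [|d d0 Hd] := FA a _ _ er0; first by rewrite subrr Normc.normc0.
pose k := Num.min (Num.min (d / 2) (rho / 2)) (rho ^+ 2 / (16 * (r + 1))).
have r1' : 0 < 16 * (r + 1) by rewrite mulr_gt0// ltr_wpDl.
have k0 : 0 < k.
  rewrite /k !lt_min -andbA; apply/and3P; split; apply: divr_gt0 => //.
  exact: exprn_gt0.
have [kd krho kr] : [/\ k <= d / 2, k <= rho / 2 & k <= rho ^+ 2 / (16 * (r + 1))].
  by rewrite /k !ge_min !lexx !orbT.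
have k2r : 2 * k * r <= rho ^+ 2 / 8.
  move: kr; rewrite ler_pdivlMr// => kr; nra.
have kC : k%:C != 0 by rewrite -nc_eq0 nc_real normr_eq0 lt0r_neq0.
pose q z := k%:C^-1 * (F (z + k%:C) - F z).
have Req z : complex.Re (q z) = (complex.Re (F (z + k%:C)) - complex.Re (F z)) / k.
  rewrite /q -ReB -fmorphV; case: (_ - _) => x y /=.
  by rewrite mul0r subr0 mulrC.
have nk : nc k%:C = k by rewrite nc_real gtr0_norm.
(* By the mean value theorem, [Re q z] is a value of [Re f] nearby, hence is
   controlled by the maximum of [U]. *)
have qmvt z : nc (z - a) <= rho ->
    exists2 th : R, 0 <= th <= k & complex.Re (q z) = complex.Re (f (z + th%:C)).
  move=> za.
  have [x|th th0k E] := @real_mvt R (fun t => complex.Re (F (z + 1 * t%:C)))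
     (fun t => complex.Re (f (z + 1 * t%:C) * 1)) 0 k k0.
    move=> /andP[x0 xk]; apply: rdiff_Re; apply: cdiff_line; apply: FA.
    rewrite mul1r addrAC; apply: le_lt_trans (ncD _ _) _.
    by rewrite nc_real ger0_norm//; lra.
  exists th => //; rewrite Req; move: E; rewrite !mul1r mulr1 addr0 subr0 => ->.
  by rewrite mulfK// lt0r_neq0.
have q_up z : nc (z - a) <= rho ->
    complex.Re (q z) + eta * nc (z - c) ^+ 2 <= U a + eta * (2 * k * r).
  move=> za; have [th /andP[th0 thk] ->] := qmvt z za.
  have zr : nc (z - c) <= r by apply: za_r; lra.
  have ztr : nc (z + th%:C - c) <= r.
    apply: za_r; rewrite addrAC; apply: le_trans (ncD _ _) _.
    rewrite nc_real ger0_norm//; lra.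
  have := Umax _ ztr; rewrite /U.
  have : nc (z - c) - nc (z + th%:C - c) <= k.
    apply: le_trans (ncB _ _) _.
    have -> : z - c - (z + th%:C - c) = - th%:C by ring.
    by rewrite ncN nc_real ger0_norm.
  have := nc_ge0 (z - c); have := nc_ge0 (z + th%:C - c).
  move: zr ztr; set s := nc (z - c); set s' := nc (z + th%:C - c) => h1 h2 h3 h4 h5 h6.
  have : s ^+ 2 - s' ^+ 2 <= 2 * k * r by nra.
  move=> /(ler_wpM2l (ltW eta0)); lra.
have q_a : complex.Re (f a) - eta * rho ^+ 2 / 8 <= complex.Re (q a).
  have := Hd (a + k%:C); rewrite addrAC subrr add0r nk => {}Hd.
  have {}Hd := Hd (le_lt_trans kd _); rewrite ltr_pdivrMr// ltr_pMr// in Hd.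
  have {}Hd := Hd (ltr1n _ 2).
  have : nc (f a - q a) <= eta * rho ^+ 2 / 8.
    have -> : f a - q a = - (k%:C^-1 * (F (a + k%:C) - F a - f a * k%:C)).
      by rewrite /q; field.
    rewrite ncN Normc.normcM Normc.normcV nk mulrC ler_pdivrMr//.
  move=> /(le_trans (normRe _)); rewrite ler_norml ReB; lra.
pose W z := complex.Re (q z) + (eta * nc (z - c) ^+ 2 + - (eta / 2) * nc (z - a) ^+ 2).
have q_diff z : nc (z - a) <= rho -> exists l, cdiff q z l.
  move=> za; exists (k%:C^-1 * (f (z + k%:C) - f z)); apply: cdiffZ; apply: cdiffB.
    apply: cdiff_shift; apply: FA; rewrite addrAC; apply: le_lt_trans (ncD _ _) _.
    by rewrite nk; lra.
  by apply: FA; lra.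
have [||b] := @evt_annulus _ W a 0 rho a.
- by rewrite subrr Normc.normc0 lexx ltW.
- move=> z /andP[_ zr]; have [l dl] := q_diff z zr.
  apply: ucontD; first by apply: ucont_Re; exact: cdiff_ccont dl.
  by apply: ucontD; exact: ucont_sqr.
rewrite nc_ge0 /= => b_rho bW.
have Wmax z : nc (z - a) <= rho -> W z <= W b.
  by move=> zr; apply: bW; rewrite nc_ge0.
have {b_rho} b_rho : nc (b - a) < rho.
  rewrite lt_neqAle b_rho andbT; apply/eqP => be.
  have := q_up b; rewrite be lexx => /(_ isT).
  have := Wmax a; rewrite subrr Normc.normc0 => /(_ (ltW rho0)).
  rewrite /W be subrr Normc.normc0 expr0n mulr0 addr0.
  have := ler_wpM2l (ltW eta0) k2r; move: q_a er0; rewrite /U.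
  lra.
have tF z : nc (z - a) < 2 * rho -> taylor2 F z.
  move=> za; have [l dl] : exists l, cdiff f z l by apply: df; apply: za_r; exact: ltW.
  apply: (@primitive_taylor2 F f z l (2 * rho - nc (z - a))) => //.
    by rewrite subr_gt0.
  move=> w wz; apply: FA; rewrite -(subrK z w) -addrA.
  by apply: le_lt_trans (ncD _ _) _; lra.
have [|d' d'0 H'] := @taylor2_mean q b _ eta eta0.
  apply: taylor2_quotient; apply: tF; first by lra.
  rewrite addrAC; apply: le_lt_trans (ncD _ _) _; rewrite nk; lra.
pose t := Num.min (d' / 2) ((rho - nc (b - a)) / 2).
have t0 : 0 < t by rewrite lt_min !divr_gt0// subr_gt0.
have [td trho] : t <= d' / 2 /\ t <= (rho - nc (b - a)) / 2.
  by rewrite /t !ge_min !lexx orbT.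
have nt : nc t%:C = t by rewrite nc_real gtr0_norm.
have nit : nc ('i * t%:C) = t by rewrite nci.
have near_b h : nc h = t -> W (b + h) <= W b.
  move=> ht; apply: Wmax; rewrite addrAC; apply: le_trans (ncD _ _) _.
  rewrite ht; lra.
have := near_b _ nt; have := near_b _ nit.
have := near_b (- t%:C); rewrite ncN => /(_ nt).
have := near_b (- ('i * t%:C)); rewrite ncN => /(_ nit).
have := H' t; have -> : 0 < t < d' by rewrite t0 /=; lra.
move=> /(_ isT).
have := sqr_mean b c t; have := sqr_mean b a t.
rewrite /W => ma mc h w1 w2 w3 w4.
have := congr1 (fun x => eta * x) mc; have := congr1 (fun x => eta / 2 * x) ma.
have : 0 < eta * t ^+ 2 by rewrite mulr_gt0// exprn_gt0.
rewrite /= !mulrDr => h1 h2 h3.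
lra.
Qed.

Lemma max_principle (f : R[i] -> R[i]) (c : R[i]) (r M : R) :
  (forall z, nc (z - c) <= r -> exists l, cdiff f z l) ->
  (forall z, nc (z - c) = r -> nc (f z) <= M) ->
  forall z, nc (z - c) <= r -> nc (f z) <= M.
Proof.
move=> df fM z0 z0r.
have [->|f0] := eqVneq (f z0) 0.
  rewrite Normc.normc0.
  apply: le_trans (nc_ge0 (f (c + r%:C))) (fM _ _).
  by rewrite addrAC subrr add0r nc_real ger0_norm// (le_trans (nc_ge0 _) z0r).
have n0 : 0 < nc (f z0) by rewrite nc_gt0.
(* Rotate [f] so that its value at [z0] is its modulus. *)
pose u := (f z0)^* / (nc (f z0))%:C.
have nu : nc u = 1.
  by rewrite Normc.normcM Normc.normcV nc_conj nc_real gtr0_norm// divff// lt0r_neq0.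
have uf : u * f z0 = (nc (f z0))%:C.
  have nz : (nc (f z0))%:C != 0 :> R[i].
    by rewrite -nc_eq0 nc_real normr_eq0 lt0r_neq0.
  rewrite /u mulrAC; apply: (mulIf nz); rewrite divfK//.
  rewrite -expr2 -rmorphXn /= nc_sqr; case: (f z0) => x y.
  by apply: ReIm_eq => /=; ring.
have := @max_principle_Re (fun z => u * f z) c r M _ _ z0 z0r.
rewrite uf /=; apply.
  by move=> z /df[l dl]; exists (u * l); exact: cdiffZ.
move=> z /fM; apply: le_trans; apply: le_trans (ler_norm _) _.
by apply: le_trans (normRe _) _; rewrite Normc.normcM nu mul1r.
Qed.

End MaximumPrinciple.

(** * Schwarz lemmas *)

Section Schwarz.
Variable R : realType.
Notation nc := (@Normc.normc R).
Implicit Types (f g h : R[i] -> R[i]) (a b z w l : R[i]).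

Lemma ccontM f g z : ccont f z -> ccont g z -> ccont (fun w => f w * g w) z.
Proof.
by move=> /ccontP fz /ccontP gz; apply/ccontP; exact: (cvgM fz gz).
Qed.

Lemma ccontD f g z : ccont f z -> ccont g z -> ccont (fun w => f w + g w) z.
Proof.
by move=> /ccontP fz /ccontP gz; apply/ccontP; exact: (cvgD fz gz).
Qed.

Lemma ccontV f z : f z != 0 -> ccont f z -> ccont (fun w => (f w)^-1) z.
Proof.
by move=> f0 /ccontP fz; apply/ccontP; exact: (cvgV f0 fz).
Qed.

Lemma ccont_cst a z : ccont (fun=> a) z.
Proof. by move=> e e0; exists 1 => // w _; rewrite subrr Normc.normc0 ltW. Qed.

Lemma ccontX f n z : ccont f z -> ccont (fun w => f w ^+ n) z.
Proof.
move=> fz; elim: n => [|n IH]; first exact: ccont_cst.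
rewrite (_ : (fun w => _) = (fun w => f w * f w ^+ n)); first exact: ccontM.
by apply/funext => w; rewrite exprS.
Qed.

(** Caratheodory's criterion *)
Lemma caratheodory f (q : R[i] -> R[i]) a (r : R) : 0 < r -> ccont q a ->
  (forall w, nc (w - a) < r -> f w - f a = (w - a) * q w) -> cdiff f a (q a).
Proof.
move=> r0 qa fE e e0; have [d d0 H] := qa e e0.
exists (Num.min d r) => [|w]; first by rewrite lt_min d0.
rewrite lt_min => /andP[/H {}H /fE ->].
have -> : (w - a) * q w - q a * (w - a) = (q w - q a) * (w - a) by ring.
by rewrite Normc.normcM ler_wpM2r ?nc_ge0.
Qed.

(** The difference quotient of [f] at [a], with value [l] at [a] *)
Definition slope f (a l w : R[i]) :=
  if w == a then l else (f w - f a) / (w - a).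

Lemma slopeE f a l w : f w - f a = (w - a) * slope f a l w.
Proof.
rewrite /slope; case: eqVneq => [->|wa]; first by rewrite !subrr mul0r.
by rewrite mulrC divfK// subr_eq0.
Qed.

Lemma slope_self f a l : slope f a l a = l.
Proof. by rewrite /slope eqxx. Qed.

Lemma slope_ccont f a l : cdiff f a l -> ccont (slope f a l) a.
Proof.
move=> fl e e0; have [d d0 H] := fl e e0; exists d => // w /H.
rewrite (slopeE f a l) slope_self; have [->|wa] := eqVneq w a.
  by move=> _; rewrite slope_self subrr Normc.normc0 ltW.
have -> : (w - a) * slope f a l w - l * (w - a) = (slope f a l w - l) * (w - a).
  by ring.
by rewrite Normc.normcM ler_pM2r// nc_gt0 subr_eq0.
Qed.

(** [f] is complex differentiable at [z]. *)
Definition cdiffable f z := exists l, cdiff f z l.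

Lemma cdiffable_ccont f z : cdiffable f z -> ccont f z.
Proof. by case=> l; exact: cdiff_ccont. Qed.

Lemma cdiffableM f g z : cdiffable f z -> cdiffable g z ->
  cdiffable (fun w => f w * g w) z.
Proof.
move=> [l fl] [m gm]; exists (f z * slope g z m z + slope f z l z * g z).
apply: (@caratheodory _ (fun w => f z * slope g z m w + slope f z l w * g w)
  z 1 ltr01).
  apply: ccontD; apply: ccontM.
  - exact: ccont_cst.
  - exact: slope_ccont.
  - exact: slope_ccont.
  - exact: cdiff_ccont gm.
move=> w _; rewrite mulrDr mulrCA -slopeE mulrA -slopeE; ring.
Qed.

Lemma cdiffableV f z :
  f z != 0 -> cdiffable f z -> cdiffable (fun w => (f w)^-1) z.
Proof.
by move=> f0 /cdiff_derivable fz; apply/cdiff_derivable; exact: derivableV.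
Qed.

Lemma cdiffable_cst a z : cdiffable (fun=> a) z.
Proof.
exists 0 => e e0; exists 1 => // w _.
by rewrite subrr mul0r subr0 Normc.normc0 mulr_ge0 ?nc_ge0 ?ltW.
Qed.

Lemma cdiffable_id z : cdiffable id z.
Proof.
exists 1 => e e0; exists 1 => // w _.
by rewrite mul1r subrr Normc.normc0 mulr_ge0 ?nc_ge0 ?ltW.
Qed.

Lemma cdiffableB f g z : cdiffable f z -> cdiffable g z ->
  cdiffable (fun w => f w - g w) z.
Proof. by move=> [l fl] [m gm]; exists (l - m); exact: cdiffB. Qed.

Lemma cdiffableD f g z : cdiffable f z -> cdiffable g z ->
  cdiffable (fun w => f w + g w) z.
Proof.
move=> fz gz; rewrite (_ : (fun w => _) = (fun w => f w - (0 - g w))).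
  by apply: cdiffableB => //; apply: cdiffableB => //; exact: cdiffable_cst.
by apply/funext => w; rewrite sub0r opprK.
Qed.

Lemma cdiffableX f n z : cdiffable f z -> cdiffable (fun w => f w ^+ n) z.
Proof.
move=> fz; elim: n => [|n IH]; first exact: cdiffable_cst.
rewrite (_ : (fun w => _) = (fun w => f w * f w ^+ n)); first exact: cdiffableM.
by apply/funext => w; rewrite exprS.
Qed.

Lemma cdiffable_near f g z (r : R) : 0 < r ->
  (forall w, nc (w - z) < r -> f w = g w) -> cdiffable f z -> cdiffable g z.
Proof.
move=> r0 fg [l fl]; exists l => e e0; have [d d0 H] := fl e e0.
exists (Num.min d r) => [|w]; first by rewrite lt_min d0.
rewrite lt_min => /andP[/H {}H /fg <-].
by rewrite -(fg z) ?subrr ?Normc.normc0.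
Qed.

Lemma slope_cdiffable f a l z :
  z != a -> cdiffable f z -> cdiffable (slope f a l) z.
Proof.
move=> za fz; apply: (@cdiffable_near (fun w => (f w - f a) * (w - a)^-1) _ z
  (nc (z - a))); first by rewrite nc_gt0 subr_eq0.
  move=> w wz; rewrite /slope; case: eqVneq => // wa.
  by move: wz; rewrite wa ncC ltxx.
apply: cdiffableM; first by apply: cdiffableB => //; exact: cdiffable_cst.
apply: cdiffableV; first by rewrite subr_eq0.
by apply: cdiffableB; [exact: cdiffable_id|exact: cdiffable_cst].
Qed.

(** A simple zero factor makes a merely continuous function differentiable at
    that zero. *)
Lemma cdiffable_mulsub (q : R[i] -> R[i]) a : ccont q a ->
  cdiffable (fun w => (w - a) * q w) a.
Proof.
move=> qa; exists (q a); apply: (caratheodory ltr01 qa) => w _.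
by rewrite subrr mul0r subr0.
Qed.

Lemma bernoulli_le (y : R) n : 0 <= y -> 1 + n%:R * y <= (1 + y) ^+ n.
Proof.
move=> y0; elim: n => [|n IH]; first by rewrite mul0r addr0 expr0.
rewrite exprS -natr1; have n0 : 0 <= n%:R :> R by [].
apply: (@le_trans _ _ ((1 + y) * (1 + n%:R * y))); last first.
  by rewrite ler_wpM2l// addr_ge0.
nra.
Qed.

(** With [q(z) = f(z) / z], continuous at [0], the function [z q(z)^(n+1)] is
    differentiable at [0] by [cdiffable_mulsub], so that the singularity of [q]
    need not be removed; letting [n] grow gives the sharp bound. *)
Lemma schwarz f : (forall z, nc z < 1 -> cdiffable f z) ->
  (forall z, nc z < 1 -> nc (f z) <= 1) -> f 0 = 0 ->
  forall z, nc z < 1 -> nc (f z) <= nc z.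
Proof.
move=> df f1 f0 z z1; have [->|z0] := eqVneq z 0; first by rewrite f0.
have [l fl] : cdiffable f 0 by apply: df; rewrite Normc.normc0.
rewrite leNgt; apply/negP => zf; set s := nc z in z1 zf *.
set b := nc (f z) in zf *; have s0 : 0 < s by rewrite nc_gt0.
have b0 : 0 < b by exact: lt_trans zf.
have b1 : b <= 1 by exact: f1.
have sb1 : s / b < 1 by rewrite ltr_pdivrMr// mul1r.
have [r [r1 rs]] : exists r, r < 1 /\ s / b < r.
  by exists ((1 + s / b) / 2); split; lra.
have sr : s < r.
  by apply: le_lt_trans rs; rewrite ler_pdivlMr// ler_piMr// ltW.
have r0 : 0 < r by exact: lt_trans sr.
pose q := slope f 0 l.
have qE w : f w = w * q w by have := slopeE f 0 l w; rewrite f0 !subr0.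
have main n : b * (b * r / s) ^+ n <= 1.
  have := @max_principle _ (fun w => (w - 0) * q w ^+ n.+1) 0 r (r ^- n) _ _ z.
  rewrite !subr0 => /(_ _ _ (ltW sr)) H.
  have {}H : nc (z * q z ^+ n.+1) <= r ^- n.
    apply: H => w; rewrite subr0 => wr.
      have w1 : nc w < 1 by exact: le_lt_trans r1.
      have [->|w0] := eqVneq w 0.
        by apply: cdiffable_mulsub; apply: ccontX; exact: slope_ccont.
      apply: cdiffableM.
        by apply: cdiffableB; [exact: cdiffable_id|exact: cdiffable_cst].
      by apply: cdiffableX; apply: slope_cdiffable => //; exact: df.
    have w0 : w != 0 by rewrite -nc_gt0 wr.
    have w1 : nc w < 1 by rewrite wr.
    rewrite Normc.normcM ncX -[leRHS]mulr1.
    have -> : nc w * nc (q w) ^+ n.+1 = r ^- n * nc (f w) ^+ n.+1.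
      rewrite qE Normc.normcM wr exprMn (exprS r); field.
      by rewrite expf_neq0// lt0r_neq0.
    rewrite ler_wpM2l ?invr_ge0 ?exprn_ge0 ?(ltW r0)//.
    by rewrite exprn_ile1 ?nc_ge0 ?f1.
  move: H; rewrite Normc.normcM ncX.
  have -> : nc (q z) = b / s.
    by rewrite /b qE Normc.normcM -/s mulrAC divff ?mul1r// lt0r_neq0.
  rewrite -/s -[r ^- n]mul1r ler_pdivlMr ?exprn_gt0//; apply: le_trans.
  rewrite le_eqVlt; apply/orP; left; apply/eqP.
  rewrite exprS !exprMn exprVn; field.
  by rewrite expf_neq0 ?lt0r_neq0.
pose y := b * r / s - 1.
have y0 : 0 < y.
  by rewrite subr_gt0 ltr_pdivlMr// mul1r mulrC -ltr_pdivrMr.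
pose n := (Num.truncn (b^-1 / y)).+1.
have ny : b^-1 < n%:R * y by rewrite -ltr_pdivrMr// truncnS_gt.
have := main n; apply/negP; rewrite -ltNge.
rewrite -(mulfV (lt0r_neq0 b0)) ltr_pM2l//.
have -> : b * r / s = 1 + y by rewrite /y; ring.
apply: lt_le_trans (bernoulli_le n (ltW y0)); lra.
Qed.

(** The Schwarz lemma for the Cayley transform [(g - g 0) / (g + conj (g 0))] *)
Lemma schwarz_half_plane g : (forall z, nc z < 1 -> cdiffable g z) ->
  (forall z, nc z < 1 -> 0 < complex.Re (g z)) ->
  forall z, nc z < 1 -> (1 - nc z ^+ 2) * nc (g z + (g 0)^*) ^+ 2 <=
    4 * complex.Re (g z) * complex.Re (g 0).
Proof.
move=> dg g0 z z1.
have n0 : nc (0 : R[i]) < 1 by rewrite Normc.normc0.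
have id4 w : nc (g w + (g 0)^*) ^+ 2 - nc (g w - g 0) ^+ 2 =
    4 * complex.Re (g w) * complex.Re (g 0).
  by rewrite !nc_sqr; case: (g w) (g 0) => [? ?] [? ?] /=; ring.
have den w : nc w < 1 -> g w + (g 0)^* != 0.
  move=> w1; apply/eqP => /(congr1 (@complex.Re R)); rewrite ReD.
  have -> : complex.Re (g 0)^* = complex.Re (g 0) by case: (g 0).
  by move=> /= e0; have := g0 _ w1; have := g0 _ n0; lra.
pose f w := (g w - g 0) * (g w + (g 0)^*)^-1.
have le1 w : nc w < 1 -> nc (g w - g 0) <= nc (g w + (g 0)^*).
  move=> w1; rewrite -(@ler_pXn2r _ 2%N) ?nnegrE ?nc_ge0// -subr_ge0 id4.
  by rewrite !mulr_ge0// ltW ?g0.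
have := @schwarz f _ _ _ z z1; rewrite /f Normc.normcM Normc.normcV.
have pos w : nc w < 1 -> 0 < nc (g w + (g 0)^*) by move=> w1; rewrite nc_gt0 den.
move=> H; have {}H : nc (g z - g 0) / nc (g z + (g 0)^*) <= nc z.
  apply: H.
  - move=> w w1; apply: cdiffableM.
      by apply: cdiffableB; [exact: dg|exact: cdiffable_cst].
    apply: cdiffableV; first exact: den.
    by apply: cdiffableD; [exact: dg|exact: cdiffable_cst].
  - move=> w w1; rewrite Normc.normcM Normc.normcV ler_pdivrMr ?pos// mul1r.
    exact: le1.
  - by rewrite subrr mul0r.
rewrite ler_pdivrMr ?pos// in H.
have := ler_pXn2r (isT : (0 < 2)%N) (nc_ge0 (g z - g 0))
  (mulr_ge0 (nc_ge0 z) (nc_ge0 (g z + (g 0)^*))).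
rewrite H exprMn => /idP H2; rewrite -id4; lra.
Qed.

(** Schwarz-Pick inequality with base point [0] *)
Lemma schwarz_pick f : (forall z, nc z < 1 -> cdiffable f z) ->
  (forall z, nc z < 1 -> nc (f z) < 1) ->
  forall z, nc z < 1 -> (1 - nc z ^+ 2) * nc (1 - (f 0)^* * f z) ^+ 2 <=
    (1 - nc (f z) ^+ 2) * (1 - nc (f 0) ^+ 2).
Proof.
move=> df f1 z z1.
have n0 : nc (0 : R[i]) < 1 by rewrite Normc.normc0.
have id4 w : nc (1 - (f 0)^* * f w) ^+ 2 - nc (f w - f 0) ^+ 2 =
    (1 - nc (f w) ^+ 2) * (1 - nc (f 0) ^+ 2).
  by rewrite !nc_sqr; case: (f w) (f 0) => [? ?] [? ?] /=; ring.
have lt1 w : nc w < 1 -> 0 < 1 - nc (f w) ^+ 2.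
  by move=> w1; rewrite subr_gt0 exprn_ilt1 ?nc_ge0 ?f1.
have pos w : nc w < 1 -> 0 < nc (1 - (f 0)^* * f w).
  move=> w1; have : 0 < nc (1 - (f 0)^* * f w) ^+ 2.
    apply: (@lt_le_trans _ _ (nc (1 - (f 0)^* * f w) ^+ 2 - nc (f w - f 0) ^+ 2)).
      by rewrite id4 mulr_gt0 ?lt1.
    by rewrite gerBl sqr_ge0.
  by rewrite exprn_even_gt0//= lt_def nc_ge0 andbT.
pose g w := (f w - f 0) * (1 - (f 0)^* * f w)^-1.
have le1 w : nc w < 1 -> nc (f w - f 0) <= nc (1 - (f 0)^* * f w).
  move=> w1; rewrite -(@ler_pXn2r _ 2%N) ?nnegrE ?nc_ge0// -subr_ge0 id4.
  by rewrite mulr_ge0 ?ltW ?lt1.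
have := @schwarz g _ _ _ z z1; rewrite /g Normc.normcM Normc.normcV.
move=> H; have {}H : nc (f z - f 0) / nc (1 - (f 0)^* * f z) <= nc z.
  apply: H.
  - move=> w w1; apply: cdiffableM.
      by apply: cdiffableB; [exact: df|exact: cdiffable_cst].
    apply: cdiffableV; first by rewrite -nc_gt0 pos.
    apply: cdiffableB; first exact: cdiffable_cst.
    by apply: cdiffableM; [exact: cdiffable_cst|exact: df].
  - move=> w w1; rewrite Normc.normcM Normc.normcV ler_pdivrMr ?pos// mul1r.
    exact: le1.
  - by rewrite subrr mul0r.
rewrite ler_pdivrMr ?pos// in H.
have := ler_pXn2r (isT : (0 < 2)%N) (nc_ge0 (f z - f 0))
  (mulr_ge0 (nc_ge0 z) (nc_ge0 (1 - (f 0)^* * f z))).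
rewrite H exprMn => /idP H2; rewrite -id4; lra.
Qed.

(** * Injective holomorphic functions do not map the disc onto the plane *)

(** Open mapping for injective maps: if [w] close to [h b] were omitted, then
    [1 / (h - w)] would violate the maximum principle. *)
Lemma injective_open h b (rho : R) : 0 < rho ->
  (forall z, nc (z - b) <= rho -> cdiffable h z) ->
  (forall z, nc (z - b) <= rho -> h z = h b -> z = b) ->
  exists2 d : R, 0 < d & forall w, nc (w - h b) < d ->
    exists2 z, nc (z - b) <= rho & h z = w.
Proof.
move=> rho0 dh hinj.
have [||a] := @evt_annulus _ (fun z => - nc (h z - h b)) b rho rho (b + rho%:C).
- by rewrite addrAC subrr add0r nc_real gtr0_norm// lexx.
- move=> z /andP[_ /dh/cdiffable_ccont hz] e e0.
  have [d d0 H] := hz e e0; exists d => // w /H hw.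
  rewrite -opprD normrN; apply: le_trans hw.
  have h1 := ncB (h w - h b) (h z - h b).
  have h2 := ncB (h z - h b) (h w - h b).
  rewrite opprB addrA subrK in h1; rewrite opprB addrA subrK [nc (h z - h w)]ncC in h2.
  by rewrite ler_norml; lra.
move=> ab; have {ab} ab : nc (a - b) = rho by apply/eqP; rewrite eq_le andbC.
move=> amin; set m := nc (h a - h b) in amin.
have m0 : 0 < m.
  rewrite nc_gt0 subr_eq0; apply/eqP => /hinj; rewrite ab lexx => /(_ isT) ab0.
  by move: ab; rewrite ab0 subrr Normc.normc0 => r0; rewrite -r0 ltxx in rho0.
exists (m / 2) => [|w wm]; first by rewrite divr_gt0.
apply: contrapT => nw.
have hw z : nc (z - b) <= rho -> h z - w != 0.
  by move=> zb; rewrite subr_eq0; apply/eqP => hzw; apply: nw; exists z.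
have bb : nc (b - b) <= rho by rewrite subrr Normc.normc0 ltW.
have := @max_principle _ (fun z => (h z - w)^-1) b rho (2 / m) _ _ b bb.
move=> H; have {}H : nc (h b - w)^-1 <= 2 / m.
  apply: H => z zb.
    apply: cdiffableV; first exact: hw.
    by apply: cdiffableB; [exact: dh|exact: cdiffable_cst].
  rewrite Normc.normcV -[2 / m]invrK lef_pV2 ?posrE ?invr_gt0 ?divr_gt0//.
    rewrite invf_div; have := amin z; rewrite zb lexx => /(_ isT).
    have := ncB (h z - h b) (w - h b).
    have -> : h z - h b - (w - h b) = h z - w by ring.
    lra.
  by rewrite nc_gt0 hw// zb.
move: H; rewrite Normc.normcV -[2 / m]invrK lef_pV2 ?posrE ?invr_gt0 ?divr_gt0//.
  by rewrite invf_div ncC leNgt wm.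
by rewrite nc_gt0 hw.
Qed.

Lemma injective_not_onto h : (forall z, nc z < 1 -> cdiffable h z) ->
  (forall z w, nc z < 1 -> nc w < 1 -> h z = h w -> z = w) ->
  exists p, forall z, nc z < 1 -> h z <> p.
Proof.
move=> dh hinj; apply: contrapT => onto.
have {onto} /choice[g gP] : forall p, exists z, nc z < 1 /\ h z = p.
  move=> p; apply: contrapT => np; apply: onto; exists p => z z1 hz.
  by apply: np; exists z.
have g1 w : nc (g w) < 1 by case: (gP w).
have hg w : h (g w) = w by case: (gP w).
have gh z : nc z < 1 -> g (h z) = z by move=> z1; apply: hinj.
have half1 : nc (2^-1 : R[i]) < 1 by rewrite Normc.normcV nc2; lra.
have n0 : nc (0 : R[i]) < 1 by rewrite Normc.normc0.
have half0 : (2^-1 : R[i]) != 0 by rewrite invr_eq0 pnatr_eq0.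
have [a [a1 [l l0 hl]]] : exists a, nc a < 1 /\ exists2 l, l != 0 & cdiff h a l.
  apply: contrapT => na.
  have dh0 z : nc z < 1 -> cdiff h z 0.
    move=> z1; have [l hl] := dh z z1; have [l0|l0] := eqVneq l 0.
      by rewrite -l0.
    by exfalso; apply: na; exists z; split => //; exists l.
  have : nc (h (0 + 2^-1 * 1%:C) - h (0 + 2^-1 * 0%:C)) <= 2 * 0 * `|1 - 0|.
    apply: (@rdiff_bound _ (fun t : R => h (0 + 2^-1 * t%:C))
      (fun=> 0 * 2^-1)) => t; last by rewrite mul0r Normc.normc0.
    rewrite min_l ?ler01// max_r ?ler01// => /andP[t0 t1].
    apply: cdiff_line; apply: dh0.
    rewrite add0r Normc.normcM nc_real ger0_norm//.
    by apply: le_lt_trans half1; rewrite ler_piMr ?nc_ge0.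
  rewrite !mulr0 mul0r mulr1 !add0r.
  rewrite le_eqVlt ltNge nc_ge0 orbF nc_eq0 subr_eq0 => /eqP /hinj.
  by move=> /(_ half1 n0)/eqP; rewrite (negPf half0).
have [z1 z11 z1a] : exists2 z1, nc z1 < 1 & z1 != a.
  by have [a0|a0] := eqVneq 0 a; [exists 2^-1; rewrite -?a0|exists 0].
(* [G w] is [(w - a)^2 / (h w - h a)]. *)
pose q := slope h a l; pose G w := (w - a) * (q w)^-1.
have qE w : h w - h a = (w - a) * q w by exact: slopeE.
have q0 w : nc w < 1 -> q w != 0.
  move=> w1; have [->|wa] := eqVneq w a; first by rewrite /q slope_self.
  apply/eqP => qw; have /eqP := qE w; rewrite qw mulr0 subr_eq0 => /eqP /hinj.
  by move=> /(_ w1 a1) /eqP; rewrite (negPf wa).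
have dG z : nc z < 1 -> cdiffable G z.
  move=> zz; have [->|za] := eqVneq z a.
    apply: cdiffable_mulsub; apply: ccontV; first exact: q0.
    exact: slope_ccont.
  apply: cdiffableM.
    by apply: cdiffableB; [exact: cdiffable_id|exact: cdiffable_cst].
  apply: cdiffableV; first exact: q0.
  by apply: slope_cdiffable => //; exact: dh.
have kappa0 : 0 < nc (G z1).
  by rewrite nc_gt0 mulf_neq0 ?invr_eq0 ?q0// subr_eq0.
set kappa := nc (G z1) in kappa0.
(* The preimage of the disc of radius [M] about [h a] lies in a disc of radius
   [r1 < 1]; on a larger circle [|h - h a| > M], whence [|G| <= 4 / M < kappa]. *)
pose M := 5 / kappa; have M0 : 0 < M by rewrite divr_gt0.
have [||w0 w0M w0max] := @evt_annulus _ (fun w => nc (g w)) (h a) 0 M (h a).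
- by rewrite subrr Normc.normc0 lexx ltW.
- move=> w _ e e0; set b := g w; have b1 : nc b < 1 := g1 w.
  pose rho := Num.min e ((1 - nc b) / 2).
  have rho0 : 0 < rho by rewrite lt_min e0 divr_gt0// subr_gt0.
  have [rhoe rhob] : rho <= e /\ rho <= (1 - nc b) / 2.
    by rewrite /rho !ge_min !lexx orbT.
  have zb1 z : nc (z - b) <= rho -> nc z < 1.
    move=> zb; rewrite -(subrK b z); apply: le_lt_trans (ncD _ _) _; lra.
  have [z zb|z zb hz|d d0 H] := @injective_open h b rho rho0.
  + by apply: dh; exact: zb1.
  + by apply: hinj => //; exact: zb1.
  exists d => // w'; rewrite -{1}(hg w) -/b => /H[z zb zw'].
  have -> : g w' = z by rewrite -zw' gh//; exact: zb1.
  apply: le_trans rhoe; apply: le_trans zb.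
  have := ncB z b; have := ncB b z; rewrite [nc (b - z)]ncC ler_norml; lra.
set r1 := nc (g w0) in w0max; have r11 : r1 < 1 := g1 w0.
pose r := (1 + Num.max r1 (Num.max (nc z1) (nc a))) / 2.
have [rr1 rr2 rr3] : [/\ r1 < r, nc z1 < r & r < 1].
  pose m := Num.max r1 (Num.max (nc z1) (nc a)).
  have m1 : m < 1 by rewrite /m !gt_max r11 z11.
  have h1 : r1 <= m by rewrite /m le_max lexx.
  have h2 : nc z1 <= m by rewrite /m !le_max lexx orbT.
  by rewrite /r -/m; split; lra.
have := @max_principle _ G 0 r (4 / M) _ _ z1; rewrite subr0 -/kappa => H.
have : kappa <= 4 / M.
  apply: H; last exact: ltW.
    by move=> z; rewrite subr0 => zr; apply: dG; exact: le_lt_trans rr3.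
  move=> z; rewrite subr0 => zr; have zz : nc z < 1 by rewrite zr.
  have hzM : M < nc (h z - h a).
    rewrite ltNge; apply/negP => zM; have := w0max (h z).
    by rewrite nc_ge0 zM gh// zr => /(_ isT); rewrite leNgt rr1.
  have za2 : nc (z - a) <= 2 by apply: le_trans (ncD _ _) _; rewrite ncN; lra.
  have GE : nc (G z) * nc (h z - h a) = nc (z - a) ^+ 2.
    by rewrite -Normc.normcM -ncX qE; congr nc; rewrite /G; field; exact: q0.
  rewrite ler_pdivlMr//; apply: (@le_trans _ _ (nc (G z) * nc (h z - h a))).
    by rewrite ler_wpM2l ?nc_ge0// ltW.
  rewrite GE (_ : 4 = 2 ^+ 2); last by ring.
  by rewrite ler_pXn2r// ?nnegrE ?nc_ge0.
have -> : 4 / M = kappa * (4 / 5) by rewrite /M; field; exact: lt0r_neq0.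
by apply/negP; rewrite -ltNge -[ltRHS]mulr1 ltr_pM2l//; lra.
Qed.

End Schwarz.

(** * Bounds on the total speed *)

Section Speed.
Variable R : realType.
Notation nc := (@Normc.normc R).

Lemma oneC : 1 = (1 : R)%:C :> R[i].
Proof. by []. Qed.

Lemma discE (z : R[i]) : disc R z = (nc z < 1) :> Prop.
Proof. by rewrite /disc /= norm_nc oneC ltcR. Qed.

Lemma holomorphic_cdiffable (f : R[i] -> R[i]) : holomorphic (disc R) f ->
  forall z, nc z < 1 -> cdiffable f z.
Proof. by move=> hf z z1; apply/cdiff_derivable; apply: hf; rewrite discE. Qed.

Lemma hyp_dist0 (z : R[i]) : hyp_dist 0 z = 2^-1 * ln ((1 + nc z) / (1 - nc z)).
Proof.
by rewrite /hyp_dist rmorph0 mul0r subr0 divr1 sub0r ncN.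
Qed.

Lemma hyp_dist0_ge (z : R[i]) (K : R) :
  nc z < 1 -> 0 < K -> 1 - nc z ^+ 2 <= K ->
  - (2^-1 * ln K) <= hyp_dist 0 z.
Proof.
move=> z1 K0 zK; rewrite hyp_dist0 -mulrN -lnV// ler_pM2l ?invr_gt0//.
have z0 := nc_ge0 z; have p1 : 0 < 1 - nc z by rewrite subr_gt0.
rewrite ler_ln ?posrE ?invr_gt0 ?divr_gt0//; last by rewrite ltr_wpDr.
rewrite ler_pdivlMr// ler_pdivrMl//; nra.
Qed.

Lemma limf_einf_gtNy (f : R -> R) (C T : R) : (forall t, T < t -> C <= f t) ->
  (-oo < limf_einf (fun t => (f t)%:E) +oo%R)%E.
Proof.
move=> H; apply: (@lt_le_trans _ _ C%:E); first exact: ltNyr.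
rewrite limf_einfE; apply: ereal_sup_ge.
exists (ereal_inf [set (f t)%:E | t in [set t | T < t]]).
  by exists [set t | T < t] => //; exists T; split => //; exact: num_real.
by apply: le_ereal_inf_tmp => _ [t /= Tt <-]; rewrite lee_fin; exact: H.
Qed.

Section Semigroup.
Variables (phi : R -> R[i] -> R[i]) (tau : R[i]).
Hypothesis sg : nonelliptic_semigroup phi.

Lemma orbit_disc t : 0 <= t -> nc (phi t 0) < 1.
Proof.
move=> t0; rewrite -discE; apply: (nes_self sg) => //.
by rewrite discE Normc.normc0.
Qed.

(** Julia's inequality at the origin, up to a factor [4]: instead of a limit,
    one radial point where the difference quotient at [tau] has modulus at most
    [2 d] is used. *)
Lemma julia_origin (f : R[i] -> R[i]) (d : R) : `|tau| = 1 ->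
  (forall z, nc z < 1 -> cdiffable f z) ->
  (forall z, nc z < 1 -> nc (f z) < 1) ->
  0 < d -> angular_derivative f tau tau d%:C ->
  1 - nc (f 0) <= 4 * d * (1 + nc (f 0)).
Proof.
move=> tau1 df f1 d0 [_ /(_ 2)]; rewrite ltr1n => /(_ isT).
have FF : Filter (within (stolz tau 2) (nbhs (tau : R[i]^o))).
  exact: within_filter.
move=> /(cvgrPdist_le (FF := FF))/(_ d%:C); rewrite ltcR => /(_ d0).
move=> /nbhs_ballP[e' /= /posC[e e0 ->]] H.
have ntau : nc tau = 1 by move: tau1; rewrite norm_nc oneC => /complexI.
have [eta [eta0 etae eta1]] : exists eta, [/\ 0 < eta, eta < e & eta < 1].
  exists (Num.min e 1 / 2); have m0 : 0 < Num.min e 1 by rewrite lt_min e0 ltr01.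
  have : Num.min e 1 <= e /\ Num.min e 1 <= 1 by rewrite !ge_min !lexx orbT.
  by move=> [? ?]; split; lra.
pose z := tau * (1 - eta)%:C.
have nz : nc z = 1 - eta.
  by rewrite Normc.normcM ntau mul1r nc_real ger0_norm// subr_ge0 ltW.
have z1 : nc z < 1 by rewrite nz; lra.
have tz : tau - z = tau * eta%:C by rewrite /z rmorphB /=; ring.
have ntz : nc (tau - z) = eta by rewrite tz Normc.normcM ntau mul1r nc_real gtr0_norm.
have := H z; rewrite ball_nc ncC ntz => /(_ etae) /(_ _).
have zS : stolz tau 2 z.
  split; first by rewrite discE.
  rewrite !norm_nc ntz nz oneC -rmorphB -rmorphM /= ltcR; lra.
move=> /(_ zS) /=; rewrite norm_nc lecR => {}H.
have zt0 : z - tau != 0 by rewrite -nc_gt0 ncC ntz.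
have fz : nc (f z - tau) <= 2 * d * eta.
  have -> : f z - tau = (f z - tau) / (z - tau) * (z - tau) by rewrite divfK.
  rewrite Normc.normcM [nc (z - tau)]ncC ntz ler_pM2r//.
  have -> : (f z - tau) / (z - tau) = d%:C - (d%:C - (f z - tau) / (z - tau)) by ring.
  apply: le_trans (ncD _ _) _; rewrite ncN nc_real gtr0_norm//; lra.
have sp := schwarz_pick df f1 z1.
have n0 : nc (0 : R[i]) < 1 by rewrite Normc.normc0.
have := f1 _ n0; have := nc_ge0 (f 0); set w := nc (f 0) in sp * => w0 w1.
have := f1 _ z1; have := nc_ge0 (f z); set u := nc (f z) in sp * => u0 u1.
have uE : 1 - u <= 2 * d * eta.
  by apply: le_trans fz; rewrite ncC -ntau; exact: ncB.
have den : 1 - w <= nc (1 - (f 0)^* * f z).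
  have := ncB 1 ((f 0)^* * f z); rewrite Normc.normc1 Normc.normcM nc_conj -/w -/u.
  nra.
rewrite nz in sp; set D := nc _ in sp den.
have h1 : eta * (1 - w) ^+ 2 <= (1 - (1 - eta) ^+ 2) * D ^+ 2.
  apply: ler_pM; rewrite ?sqr_ge0 ?(ltW eta0)//; first by nra.
  by rewrite ler_pXn2r ?nnegrE ?subr_ge0 ?(ltW w1)//; exact: nc_ge0.
have h2 : (1 - u ^+ 2) * (1 - w ^+ 2) <= 4 * d * eta * (1 - w ^+ 2).
  apply: ler_wpM2r; last by nra.
  by rewrite subr_ge0 exprn_ile1// ltW.
have h3 : eta * (1 - w) ^+ 2 <= 4 * d * eta * (1 - w ^+ 2).
  exact: le_trans h1 (le_trans sp h2).
have p : 0 < eta * (1 - w) by rewrite mulr_gt0// subr_gt0.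
rewrite -(ler_pM2l p); apply: le_trans (le_trans _ h3) _.
  by rewrite expr2 mulrA.
by rewrite le_eqVlt; apply/orP; left; apply/eqP; ring.
Qed.

Lemma speed_hyperbolic (lambda t : R) : `|tau| = 1 -> 0 <= t ->
  angular_derivative (phi t) tau tau (expR (- (lambda * t)))%:C ->
  - (2^-1 * ln 4) <= total_speed phi t - lambda / 2 * t.
Proof.
move=> tau1 t0 dphi; have d0 := expR_gt0 (- (lambda * t)).
have J : 1 - nc (phi t 0) <= 4 * expR (- (lambda * t)) * (1 + nc (phi t 0)).
  apply: julia_origin dphi => //.
    by apply: holomorphic_cdiffable; exact: nes_holo sg t t0.
  by move=> z z1; rewrite -discE; apply: (nes_self sg) => //; rewrite discE.
rewrite /total_speed hyp_dist0.
have r1 := orbit_disc t0; have r0 := nc_ge0 (phi t 0).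
set r := nc _ in J r0 r1 *.
have p1 : 0 < 1 - r by rewrite subr_gt0.
have p2 : 0 < 1 + r by rewrite ltr_wpDr.
have : ln ((4 * expR (- (lambda * t)))^-1) <= ln ((1 + r) / (1 - r)).
  rewrite ler_ln ?posrE ?invr_gt0 ?mulr_gt0 ?invr_gt0//.
  by rewrite ler_pdivlMr// ler_pdivrMl ?mulr_gt0// mulrC.
rewrite lnV ?posrE ?mulr_gt0// lnM ?posrE// expRK; lra.
Qed.

(** [s = 1] is the model on the right half plane, [s = -1] on the left one. *)
Lemma speed_half_plane (h : R[i] -> R[i]) (s : R) : holomorphic (disc R) h ->
  s ^+ 2 = 1 ->
  (forall z, nc z < 1 -> 0 < s * complex.Re (h z)) ->
  (forall t z, 0 <= t -> disc R z -> h (phi t z) = h z + t*i) ->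
  forall t, 0 < t ->
    - (2^-1 * ln (4 * (complex.Re (h 0)) ^+ 2)) <= total_speed phi t - ln t.
Proof.
move=> hh s1 hs hphi t t0.
have n0 : nc (0 : R[i]) < 1 by rewrite Normc.normc0.
pose g z := s%:C * h z.
have reg z : complex.Re (g z) = s * complex.Re (h z).
  by rewrite /g; case: (h z) => ? ? /=; rewrite mul0r subr0.
have dg z : nc z < 1 -> cdiffable g z.
  move=> z1; apply: cdiffableM; first exact: cdiffable_cst.
  exact: holomorphic_cdiffable hh z z1.
have r1 := orbit_disc (ltW t0).
have := @schwarz_half_plane _ g dg _ _ r1.
have d0 : disc R 0 by rewrite discE.
rewrite /g !hphi ?(ltW t0)// => /(_ _) H.
have {}H := H (fun z z1 => eq_ind_r (fun x => 0 < x) (hs z z1) (reg z)).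
have a0 : 0 < (complex.Re (h 0)) ^+ 2.
  have := hs _ n0; rewrite -[_ ^+ 2]mul1r -s1 -exprMn => ?; exact: exprn_gt0.
have K : 1 - nc (phi t 0) ^+ 2 <= 4 * (complex.Re (h 0)) ^+ 2 / t ^+ 2.
  rewrite ler_pdivlMr ?exprn_gt0//; apply: le_trans (le_trans _ H) _.
    apply: ler_wpM2l; first by rewrite subr_ge0 exprn_ile1 ?nc_ge0// ltW.
    rewrite nc_sqr; case: (h 0) a0 => a b /= a0.
    rewrite -[leLHS]mul1r -s1; nra.
  case: (h 0) => a b /=; rewrite le_eqVlt; apply/orP; left; apply/eqP.
  have -> : 4 * a ^+ 2 = 4 * a ^+ 2 * s ^+ 2 by rewrite s1 mulr1.
  ring.
have tt : 0 < t ^+ 2 by exact: exprn_gt0.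
have K1 : 0 < 4 * (complex.Re (h 0)) ^+ 2 by exact: mulr_gt0.
have K0 : 0 < 4 * (complex.Re (h 0)) ^+ 2 / t ^+ 2 by exact: divr_gt0.
have := hyp_dist0_ge r1 K0 K; rewrite /total_speed.
rewrite ln_div ?posrE// lnXn//; lra.
Qed.

(** A square root of [- i (h - p)] on the disc with positive real part exists
    as soon as [h] omits the vertical half-line below [p]. *)
Lemma koebe_sqrt (h : R[i] -> R[i]) (p : R[i]) : holomorphic (disc R) h ->
  (forall t z, 0 <= t -> nc z < 1 -> h z + t*i <> p) ->
  exists g : R[i] -> R[i], [/\ forall z, nc z < 1 -> 0 < complex.Re (g z),
    forall z, nc z < 1 -> g z ^+ 2 = - 'i * (h z - p) &
    forall z, nc z < 1 -> cdiffable g z].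
Proof.
move=> hh hp; pose x z := - 'i * (h z - p).
have /choice[g gP] : forall z, exists s : R[i],
    nc z < 1 -> 0 < complex.Re s /\ s ^+ 2 = x z.
  move=> z; have [z1|] := ltP (nc z) 1; last by exists 0.
  pose s := sqrtc (x z); have sE : s ^+ 2 = x z by exact: sqr_sqrtc.
  have [s0|s0|s0] := ltgtP 0 (complex.Re s).
  - by exists s.
  - exists (- s) => _; rewrite sqrrN; split => //.
    by move: s0; case: (s) => ? ? /=; rewrite oppr_gt0.
  - exfalso; apply: (hp (complex.Im s ^+ 2) z (sqr_ge0 _) z1).
    have hE : h z = p + 'i * x z.
      by rewrite /x mulrA mulrN -expr2 sqr_i opprK mul1r addrC subrK.
    rewrite hE -sE; case: (s) s0 => a b /= <-; case: (p) => c d.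
    by apply: ReIm_eq => /=; ring.
have g0 z : nc z < 1 -> 0 < complex.Re (g z) by move=> /gP[].
have g2 z : nc z < 1 -> g z ^+ 2 = x z by move=> /gP[].
exists g; split => // z z1.
have zw w : nc (w - z) < 1 - nc z -> nc w < 1.
  by move=> wz; rewrite -(subrK z w); apply: le_lt_trans (ncD _ _) _; lra.
have rz : 0 < 1 - nc z by rewrite subr_gt0.
have dx : cdiffable x z.
  apply: cdiffableM; first exact: cdiffable_cst.
  apply: cdiffableB; last exact: cdiffable_cst.
  exact: holomorphic_cdiffable hh z z1.
have diff w : nc w < 1 -> x w - x z = (g w - g z) * (g w + g z).
  by move=> w1; rewrite -!g2// -subr_sqr.
have sum_ge w : nc w < 1 -> complex.Re (g z) <= nc (g w + g z).
  move=> w1; apply: le_trans (le_trans (ler_norm _) (normRe _)).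
  by rewrite ReD lerDr ltW// g0.
have sum0 w : nc w < 1 -> g w + g z != 0.
  by move=> w1; rewrite -nc_gt0; apply: lt_le_trans (sum_ge w w1); exact: g0.
have gc : ccont g z.
  move=> e e0; have a0 := g0 z z1.
  have [d d0 H] := cdiffable_ccont dx (mulr_gt0 e0 a0).
  exists (Num.min d (1 - nc z)) => [|w]; first by rewrite lt_min d0.
  rewrite lt_min => /andP[/H {}H /zw w1].
  rewrite -(ler_pM2r a0); apply: le_trans H.
  by rewrite diff// Normc.normcM ler_wpM2l ?nc_ge0 ?sum_ge.
have [l xl] := dx; exists (slope x z l z * (g z + g z)^-1).
apply: (@caratheodory _ g (fun w => slope x z l w * (g w + g z)^-1) z (1 - nc z)) => //.
  apply: ccontM; first exact: slope_ccont.
  by apply: ccontV; [exact: sum0|apply: ccontD => //; exact: ccont_cst].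
move=> w /zw w1; rewrite mulrA -slopeE diff// mulfK//; exact: sum0.
Qed.

Lemma speed_koebe (h : R[i] -> R[i]) (p : R[i]) : holomorphic (disc R) h ->
  (forall t z, 0 <= t -> nc z < 1 -> h z + t*i <> p) ->
  (forall t z, 0 <= t -> disc R z -> h (phi t z) = h z + t*i) ->
  exists C T, forall t, T < t -> C <= total_speed phi t - 4^-1 * ln t.
Proof.
move=> hh hp hphi; have [g [g0 g2 dg]] := koebe_sqrt hh hp.
have n0 : nc (0 : R[i]) < 1 by rewrite Normc.normc0.
have d0 : disc R 0 by rewrite discE.
pose a := complex.Re (g 0); have a0 : 0 < a by exact: g0.
pose b := complex.Re (- 'i * (h 0 - p)).
exists (- (4^-1 * ln (32 * a ^+ 2))), (2 * `|b|) => t bt.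
have t0 : 0 < t by apply: le_lt_trans bt; rewrite mulr_ge0.
have r1 := orbit_disc (ltW t0).
pose x := complex.Re (g (phi t 0)); have x0 : 0 < x by exact: g0.
have x2 : t / 2 <= x ^+ 2.
  have : complex.Re (g (phi t 0) ^+ 2) = b + t.
    rewrite g2// hphi ?(ltW t0)// /b; case: (h 0) => ? ?; case: (p) => ? ? /=; ring.
  rewrite /x; case: (g _) => u v /= uv; have := ler_norm (- b); rewrite normrN.
  have := sqr_ge0 v; rewrite expr2; nra.
have H := schwarz_half_plane dg g0 r1; rewrite -/x -/a in H.
have S0 : 0 < 1 - nc (phi t 0) ^+ 2.
  by rewrite subr_gt0 exprn_ilt1 ?nc_ge0.
have H1 : (1 - nc (phi t 0) ^+ 2) * x <= 4 * a.
  rewrite -(ler_pM2r x0) -mulrA -expr2 [leRHS]mulrAC; apply: le_trans H.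
  apply: ler_wpM2l; first exact: ltW.
  rewrite ler_pXn2r ?nnegrE ?nc_ge0 ?(ltW x0)//.
  apply: le_trans (le_trans (ler_norm _) (normRe _)).
  rewrite ReD (_ : complex.Re (g 0)^* = a); last by rewrite /a; case: (g 0).
  by rewrite lerDl ltW.
have H2 : (1 - nc (phi t 0) ^+ 2) ^+ 2 <= 32 * a ^+ 2 / t.
  rewrite ler_pdivlMr//.
  have : ((1 - nc (phi t 0) ^+ 2) * x) ^+ 2 <= (4 * a) ^+ 2.
    by rewrite ler_pXn2r ?nnegrE ?mulr_ge0 ?(ltW S0) ?(ltW x0) ?(ltW a0).
  rewrite !exprMn; have := ler_wpM2l (sqr_ge0 (1 - nc (phi t 0) ^+ 2)) x2.
  lra.
have A1 : 0 < 32 * a ^+ 2 by apply: mulr_gt0 => //; exact: exprn_gt0.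
have A2 : 0 < 32 * a ^+ 2 / t by exact: divr_gt0.
have S2 : 0 < (1 - nc (phi t 0) ^+ 2) ^+ 2 by exact: exprn_gt0.
have := hyp_dist0_ge r1 S0 (lexx _); rewrite /total_speed.
have : ln ((1 - nc (phi t 0) ^+ 2) ^+ 2) <= ln (32 * a ^+ 2 / t).
  by rewrite ler_ln ?posrE.
rewrite lnXn// ln_div ?posrE ?mulr_gt0 ?exprn_gt0//; lra.
Qed.

End Semigroup.
End Speed.

Theorem proposition6p2 (R : realType) (phi : R -> R[i] -> R[i]) (tau : R[i]) :
  nonelliptic_semigroup phi -> denjoy_wolff phi tau ->
  [/\ (forall lambda : R, 0 < lambda -> hyperbolic phi ->
        spectral_value phi tau lambda ->
        (-oo < limf_einf
          (fun t : R => (total_speed phi t - lambda / 2 * t)%:E) +oo%R)%E),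
      (parabolic_positive_step phi ->
        (-oo < limf_einf
          (fun t : R => (total_speed phi t - ln t)%:E) +oo%R)%E) &
      (parabolic_zero_step phi ->
        (-oo < limf_einf
          (fun t : R => (total_speed phi t - 4^-1 * ln t)%:E) +oo%R)%E)].
Proof.
move=> sg [tau1 _]; split.
- move=> lambda _ _ [_ sv].
  apply: (@limf_einf_gtNy _ _ (- (2^-1 * ln 4)) 0) => t t0.
  by apply: (speed_hyperbolic sg tau1 (ltW t0)); exact: sv (ltW t0).
- move=> [h []] [[hh _] _ hphi OmE].
  + apply: (limf_einf_gtNy (T := 0)) => t t0.
    apply: (speed_half_plane sg hh (expr1n _ 2) _ hphi t0) => z z1.
    have : @right_half_plane R (h z - 0*i).
      by rewrite OmE; exists 0 => //; exists z => //; rewrite discE.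
    by rewrite /right_half_plane /= ReB /= subr0 mul1r.
  + apply: (limf_einf_gtNy (T := 0)) => t t0.
    apply: (speed_half_plane sg hh (s := -1) _ _ hphi t0) => [|z z1].
      by rewrite sqrrN expr1n.
    have : @left_half_plane R (h z - 0*i).
      by rewrite OmE; exists 0 => //; exists z => //; rewrite discE.
    by rewrite /left_half_plane /= ReB /= subr0 mulN1r oppr_gt0.
- move=> [h [[hh hinj] hup hphi _]].
  have [p hp] : exists p, forall z, Normc.normc z < 1 -> h z <> p.
    apply: injective_not_onto; first exact: holomorphic_cdiffable.
    by move=> z w z1 w1; apply: hinj; rewrite inE discE.
  have [|C [T H]] := @speed_koebe _ _ sg h p hh _ hphi.
    move=> t z t0 z1 e.
    have [] := hup t (h z) t0; first by exists z => //; rewrite discE.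
    by move=> w; rewrite discE => w1; rewrite e; exact: hp.
  exact: limf_einf_gtNy H.
Qed.
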